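(* Let $m=3$. Then omnivocal communication is necessary for achieving SK capacity, i.e. $\mathbf I_T(X_{\mathcal M})<\mathbf I(X_{\mathcal M})$ for every $T\subset\mathcal M$ with $|T|=2$, if and only if the singleton partition $\mathcal S$ is the unique minimizer in the definition of $\mathbf I(X_{\mathcal M})$. Equivalently, the condition is $$\Delta(\mathcal S)<\min\{I(X_{\{1,2\}};X_3),\,I(X_{\{1,3\}};X_2),\,I(X_{\{2,3\}};X_1)\}.$$
   Context: Let $\mathcal M=\{1,2,3\}$, and let $X_{\mathcal M}=(X_1,X_2,X_3)$ be jointly distributed finite-valued random variables, observed as $n$ i.i.d. copies; $X_A=(X_i:i\in A)$. Communication, CR, SK. An interactive communication $\mathbf F$ is a finite sequence of transmissions, each made by a terminal $i$ as a deterministic function of $X^n_i$ and earlier transmissions. A CR from $\mathbf F$ is a sequence $\mathbf J$ of functions of $X^n_{\mathcal M}$ such that for every $0<\epsilon<1$ and large $n$, there exist $J_i(X^n_i,\mathbf F)$ with $\Pr[J_1=J_2=J_3=\mathbf J]\ge1-\epsilon$. $R$ is an achievable SK rate if some CR $\mathbf K$ from some $\mathbf F$ satisfies, for every $\epsilon>0$ and large $n$, $I(\mathbf K;\mathbf F)\le\epsilon$ and $\frac1nH(\mathbf K)\ge R-\epsilon$. Multipartite information. $\Delta(\mathcal P)=\frac1{|\mathcal P|-1}[\sum_{A\in\mathcal P}H(X_A)-H(X_{\mathcal M})]$, and $\mathbf I(X_{\mathcal M})=\min_{\mathcal P}\Delta(\mathcal P)$ over partitions with at least 2 cells; this equals the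 SK capacity. In particular $\Delta(\mathcal S)=\frac12[H(X_1)+H(X_2)+H(X_3)-H(X_{\mathcal M})]$ for $\mathcal S=\{\{1\},\{2\},\{3\}\}$. Silent terminals. For $T\subsetneq\mathcal M$, $\mathbf I_T(X_{\mathcal M})$ is the supremum of SK rates achievable using interactive communications in which only terminals in $T$ transmit. *)

(* Defs.v *)
From Stdlib Require Import Reals.
From Stdlib Require List.
From HB Require Import structures.
From mathcomp Require Import all_boot.

Set Implicit Arguments.
Unset Strict Implicit.
Unset Printing Implicit Defensive.

Local Open Scope R_scope.

(* Terminals M = {1,2,3} are represented by 'I_3 = {0,1,2}. *)

Definition t1 : 'I_3 := inord 0%N.
Definition t2 : 'I_3 := inord 1%N.
Definition t3 : 'I_3 := inord 2%N.

Definition finRsum (T : finType) (P : pred T) (f : T -> R) : R :=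
  \big[Rplus/R0]_(x : T | P x) f x.

(** Entropy (natural log) of the random variable whose values are the
    classes of the equivalence relation [e] on the finite sample space
    [Om] with pmf [w]:  H = - sum_x w(x) ln Pr[class of x].
    For e x y := (f x == f y) this is exactly H(f). *)
Definition Hrel (Om : finType) (w : Om -> R) (e : Om -> Om -> bool) : R :=
  (- finRsum predT (fun x => w x * ln (finRsum (e x) w))).

Definition Ent (Om : finType) (w : Om -> R) (V : eqType) (f : Om -> V) : R :=
  Hrel w (fun x y => f x == f y).

Definition MI (Om : finType) (w : Om -> R) (V W : eqType)
  (f : Om -> V) (g : Om -> W) : R :=
  (Ent w f + Ent w g - Ent w (fun x => (f x, g x))).

Definition Prob (Om : finType) (w : Om -> R) (E : pred Om) : R := finRsum E w.

Section Source.
Variable X : 'I_3 -> finType.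
Definition Sample := {dffun forall i : 'I_3, X i}.
Variable P : Sample -> R.

(** X_A, as the equivalence "the samples agree on the coordinates in A". *)
Definition agreeA (A : {set 'I_3}) (x y : Sample) : bool :=
  [forall i in A, x i == y i].

Definition HA (A : {set 'I_3}) : R := Hrel P (agreeA A).

Definition MIA (A B : {set 'I_3}) : R := (HA A + HA B - HA (A :|: B)).

Definition DeltaPart (Pi : {set {set 'I_3}}) : R :=
  ((finRsum (fun A => A \in Pi) HA - HA setT) / (INR #|Pi| - 1)).

Definition is_part (Pi : {set {set 'I_3}}) : bool :=
  finset.partition Pi [set: 'I_3] && (1 < #|Pi|)%N.

Definition Ssing : {set {set 'I_3}} := [set [set i] | i : 'I_3].

Definition Imulti : R :=
  \big[Rmin/DeltaPart Ssing]_(Pi : {set {set 'I_3}} | is_part Pi) DeltaPart Pi.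

Definition S_unique_minimizer : Prop :=
  forall Pi, is_part Pi -> Pi <> Ssing -> (DeltaPart Ssing < DeltaPart Pi).

Definition SampleN (n : nat) := {ffun 'I_n -> Sample}.
Definition Pn (n : nat) (x : SampleN n) : R := \big[Rmult/R1]_(k < n) P (x k).

Definition agree_i (n : nat) (i : 'I_3) (x y : SampleN n) : bool :=
  [forall k, x k i == y k i].

(** A transmission: the transmitting terminal and the message function,
    taking the earlier transmissions and the (whole) data; the message
    must depend on the data only through X_i^n. Messages are encoded
    as naturals (the data space is finite). *)
Definition trans (n : nat) := ('I_3 * (seq nat -> SampleN n -> nat))%type.
Definition protocol (n : nat) := seq (trans n).

Definition local_trans (n : nat) (t : trans n) : Prop :=
  forall prev x y, agree_i t.1 x y -> t.2 prev x = t.2 prev y.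

Definition valid_protocol (n : nat) (p : protocol n) : Prop :=
  List.Forall (@local_trans n) p.

Definition only_from (T : {set 'I_3}) (n : nat) (p : protocol n) : Prop :=
  List.Forall (fun t : trans n => t.1 \in T) p.

Fixpoint run (n : nat) (p : protocol n) (prev : seq nat) (x : SampleN n)
  : seq nat :=
  match p with
  | [::] => prev
  | t :: p' => run p' (rcons prev (t.2 prev x)) x
  end.

Definition transcript (n : nat) (p : protocol n) (x : SampleN n) : seq nat :=
  run p [::] x.

Definition is_CR (F : forall n, protocol n) (J : forall n, SampleN n -> nat)
  : Prop :=
  forall eps : R, (0 < eps < 1) ->
  exists N : nat, forall n : nat, (N <= n)%N ->
    exists Ji : 'I_3 -> SampleN n -> nat,
      (forall i x y, agree_i i x y -> transcript (F n) x = transcript (F n) y ->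
                     Ji i x = Ji i y) /\
      (Prob (@Pn n) (fun x => [forall i, Ji i x == J n x]) >= 1 - eps).

Definition sk_achievable_T (T : {set 'I_3}) (Rt : R) : Prop :=
  exists (F : forall n, protocol n) (K : forall n, SampleN n -> nat),
    (forall n, valid_protocol (F n) /\ only_from T (F n)) /\
    is_CR F K /\
    forall eps : R, (0 < eps) ->
      exists N : nat, forall n : nat, (N <= n)%N ->
        (MI (@Pn n) (K n) (transcript (F n)) <= eps) /\
        (Ent (@Pn n) (K n) / INR n >= Rt - eps).

End Source.

(* Main.v *)
Require Import Defs.
From Stdlib Require Import Reals Lra Psatz ZArith IndefiniteDescription.
From HB Require Import structures.
From mathcomp Require Import all_boot.

(** With c the silent terminal and T = {a,b}, the singleton partition satisfies
    Delta(S) = (I(Xa;Xb) + I(Xa,Xb;Xc)) / 2, so Delta(S) < I(Xa,Xb;Xc) if and only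
    if I(Xa;Xb) < Delta(S).

    If S is the unique minimizer, then I_T <= I(Xa;Xb) < Delta(S), by Fano's
    inequality and because I(Xa^n;Xb^n|F) does not increase along a
    communication F from a and b.

    Otherwise I(Xa,Xb;Xc) <= Delta(S), hence I(Xa,Xb;Xc) <= I(Xa;Xb), for some c,
    and every rate r < I(Xa,Xb;Xc) is achieved by random binning: a and b publish
    random hashes of Xa^n and Xb^n at rates slightly above H(Xa|Xb) and H(Xb|Xa),
    everybody recovers (Xa^n,Xb^n), and the key is a further random hash of this
    pair.  The decoding errors and the leaked information are both bounded through
    pairwise collision probabilities by averages of ln (1 + u), where u is
    a product of n i.i.d. factors whose logarithms have negative mean; such an
    average tends to 0 because E[exp (s Z)] < 1 for small s > 0 when E[Z] < 0. *)

Set Implicit Arguments.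
Unset Strict Implicit.
Unset Printing Implicit Defensive.

Local Open Scope R_scope.

(** The rate I(Xa,Xb;Xc) reached by the talkers a and b is Delta of the partition into {a,b} and
    {c}, hence at least I(X_M); reaching it for a single c already refutes I_T < I(X_M). Secrecy
    bounds I(K;F) itself and not its rate, so a leakage that is merely o(n) is too much. This is
    what the shape ln (1 + u) is for. Leakage is the mean of the logarithm of a probability times an
    alphabet size, and a decoding error is brought to the same shape by 1 <= 2 ln 2. As ln is
    concave, the average over the random code moves inside it, where only the collision of two
    source points matters. On rare events the logarithm may still be of order n; the bound ln (1 +
    exp z) <= exp (s z) / s replaces it by an exponential moment, which factorizes over the
    coordinates and decays exponentially. *)

HB.instance Definition _ := Monoid.isComLaw.Build R R0 Rplus
  (fun x y z => esym (Rplus_assoc x y z)) Rplus_comm Rplus_0_l.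
HB.instance Definition _ := Monoid.isComLaw.Build R R1 Rmult
  (fun x y z => esym (Rmult_assoc x y z)) Rmult_comm Rmult_1_l.
HB.instance Definition _ := Monoid.isMulLaw.Build R R0 Rmult Rmult_0_l Rmult_0_r.
HB.instance Definition _ := Monoid.isAddLaw.Build R Rmult Rplus
  Rmult_plus_distr_r Rmult_plus_distr_l.

Notation "\sum_ ( i | P ) F" := (\big[Rplus/R0]_(i | P%B) F) : R_scope.
Notation "\sum_ ( i : t | P ) F" := (\big[Rplus/R0]_(i : t | P%B) F) (only parsing) : R_scope.
Notation "\sum_ ( i : t ) F" := (\big[Rplus/R0]_(i : t) F) (only parsing) : R_scope.
Notation "\sum_ i F" := (\big[Rplus/R0]_i F) : R_scope.
Notation "\sum_ ( i < n ) F" := (\big[Rplus/R0]_(i < n) F) : R_scope.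
Notation "\prod_ ( i : t ) F" := (\big[Rmult/R1]_(i : t) F) (only parsing) : R_scope.
Notation "\prod_ i F" := (\big[Rmult/R1]_i F) : R_scope.
Notation "\prod_ ( i < n ) F" := (\big[Rmult/R1]_(i < n) F) : R_scope.

(** * Finite real sums and elementary bounds on the logarithm *)

Definition ind (b : bool) : R := if b then 1 else 0.

Lemma ind_ge0 b : 0 <= ind b.
Proof. by case: b => /=; lra. Qed.

Section Sums.
Variable I : finType.
Implicit Types (P Q : pred I) (F G : I -> R).

Lemma sumR_le P F G : (forall i, P i -> F i <= G i) ->
  \sum_(i | P i) F i <= \sum_(i | P i) G i.
Proof. by move=> FG; elim/big_ind2: _ => //; [lra | move=> *; lra]. Qed.

Lemma sumR_ge0 P F : (forall i, P i -> 0 <= F i) -> 0 <= \sum_(i | P i) F i.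
Proof. by move=> F0; elim/big_ind: _ => //; [lra | move=> *; lra]. Qed.

Lemma mulR_sumr P F c : c * (\sum_(i | P i) F i) = \sum_(i | P i) (c * F i).
Proof. by rewrite big_distrr. Qed.

Lemma mulR_suml P F c : (\sum_(i | P i) F i) * c = \sum_(i | P i) (F i * c).
Proof. by rewrite big_distrl. Qed.

Lemma sumRD P F G : \sum_(i | P i) (F i + G i) = \sum_(i | P i) F i + \sum_(i | P i) G i.
Proof. by rewrite big_split. Qed.

Lemma sumRN P F : \sum_(i | P i) (- F i) = - \sum_(i | P i) F i.
Proof. by elim/big_ind2: _ => [|x y z t -> ->|//]; lra. Qed.

Lemma sumRB P F G : \sum_(i | P i) (F i - G i) = \sum_(i | P i) F i - \sum_(i | P i) G i.
Proof. by rewrite sumRD sumRN. Qed.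

Lemma sumR_ind P F : \sum_(i | P i) F i = \sum_i (ind (P i) * F i).
Proof.
rewrite big_mkcond; apply: eq_bigr => i _.
by case: (P i); rewrite /= ?Rmult_1_l ?Rmult_0_l.
Qed.

Lemma sumR_le_pred P Q F : (forall i, 0 <= F i) -> (forall i, P i -> Q i) ->
  \sum_(i | P i) F i <= \sum_(i | Q i) F i.
Proof.
move=> F0 PQ; rewrite (sumR_ind P) (sumR_ind Q); apply: sumR_le => i _.
move: (PQ i) (F0 i); rewrite /ind; case: (P i) => [/(_ isT) -> _|_ F0i]; first lra.
by case: (Q i); lra.
Qed.

Lemma sumR_term P F i : (forall j, 0 <= F j) -> P i -> F i <= \sum_(j | P j) F j.
Proof.
move=> F0 Pi; rewrite (bigD1 i) //=.
have := sumR_ge0 (P := fun j => P j && (j != i)) (fun j _ => F0 j).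
by move=> ?; lra.
Qed.

Lemma sumR_const P c : \sum_(i | P i) c = INR #|P| * c.
Proof.
rewrite big_const; elim: #|P| => [|k IH]; first by rewrite /=; lra.
by rewrite S_INR iterS IH; lra.
Qed.

End Sums.

Lemma exchange_sumR (I J : finType) (F : I -> J -> R) :
  \sum_i \sum_j F i j = \sum_j \sum_i F i j.
Proof. by rewrite exchange_big. Qed.

Lemma ln_le_sub1 x : 0 < x -> ln x <= x - 1.
Proof.
move=> x0; have := exp_ineq1_le (ln x); rewrite exp_ln //; lra.
Qed.

Lemma ln_div x y : 0 < x -> 0 < y -> ln (x / y) = ln x - ln y.
Proof.
by move=> x0 y0; rewrite ln_mult ?ln_Rinv //; apply: Rinv_0_lt_compat.
Qed.

Lemma ln_le_mono x y : 0 < x -> x <= y -> ln x <= ln y.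
Proof.
move=> x0 [xy|->]; last lra.
by left; apply: ln_increasing.
Qed.

(** * Entropy inequalities on a finite probability space *)

Section Entropy.
Variables (Om : finType) (w : Om -> R).
Hypotheses (w0 : forall x, 0 <= w x) (w1 : \sum_x w x = 1).

(** Pr[f = f x]. Entropies see a random variable only through its kernel, so variables with values
    in different types are compared by [refines] and exchanged by [Ent_kernel]. *)
Definition cls (V : eqType) (f : Om -> V) (x : Om) : R :=
  \sum_(y | f x == f y) w y.

Definition refines (U V : Type) (f : Om -> U) (g : Om -> V) : Prop :=
  forall x y, f x = f y -> g x = g y.

Lemma EntE (V : eqType) (f : Om -> V) : Ent w f = - \sum_x (w x * ln (cls f x)).
Proof. by []. Qed.

Lemma w_split x : w x = 0 \/ 0 < w x.
Proof. by have [?|<-] := Rle_lt_or_eq_dec _ _ (w0 x); [right | left]. Qed.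

Lemma cls_ge0 (V : eqType) (f : Om -> V) x : 0 <= cls f x.
Proof. by apply: sumR_ge0. Qed.

Lemma le_w_cls (V : eqType) (f : Om -> V) x : w x <= cls f x.
Proof. exact: (@sumR_term _ (fun y => f x == f y)). Qed.

Lemma cls_gt0 (V : eqType) (f : Om -> V) x : 0 < w x -> 0 < cls f x.
Proof. by move=> ?; have := le_w_cls f x; lra. Qed.

Lemma cls_le1 (V : eqType) (f : Om -> V) x : cls f x <= 1.
Proof. by rewrite -w1; apply: sumR_le_pred. Qed.

Lemma eq_cls (V : eqType) (f : Om -> V) x y : f x = f y -> cls f x = cls f y.
Proof. by move=> fxy; apply: eq_bigl => z; rewrite fxy. Qed.

Lemma cls_kernel (U V : eqType) (f : Om -> U) (g : Om -> V) :
  refines f g -> refines g f -> cls f =1 cls g.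
Proof.
by move=> fg gf x; apply: eq_bigl => y; apply/eqP/eqP => [/fg|/gf].
Qed.

Lemma cls_refines (U V : eqType) (f : Om -> U) (g : Om -> V) x :
  refines f g -> cls f x <= cls g x.
Proof. by move=> fg; apply: sumR_le_pred => // y /eqP/fg ->. Qed.

Lemma Ent_kernel (U V : eqType) (f : Om -> U) (g : Om -> V) :
  refines f g -> refines g f -> Ent w f = Ent w g.
Proof.
by move=> fg gf; rewrite !EntE; congr (- _); apply: eq_bigr => x _; rewrite (cls_kernel fg gf).
Qed.

Lemma Hrel_kernel (V : eqType) (f : Om -> V) e :
  (forall x y, e x y = (f x == f y)) -> Hrel w e = Ent w f.
Proof.
move=> ef; congr (- _); apply: eq_bigr => x _; congr (w x * ln _).
by apply: eq_bigl => y; rewrite ef.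
Qed.

Lemma cls_cst (V : eqType) (v : V) x : cls (fun=> v) x = 1.
Proof. by rewrite -w1; apply: eq_bigl => y; rewrite eqxx. Qed.

Lemma Ent_cst (V : eqType) (v : V) : Ent w (fun=> v) = 0.
Proof.
rewrite EntE big1 ?Ropp_0 // => x _.
by rewrite cls_cst ln_1 Rmult_0_r.
Qed.

Lemma Ent_ge0 (V : eqType) (f : Om -> V) : 0 <= Ent w f.
Proof.
rewrite EntE -sumRN; apply: sumR_ge0 => x _.
case: (w_split x) => [->|wx]; first by lra.
have := ln_le_sub1 (cls_gt0 f wx); have := cls_le1 f x.
move=> ? ?; have : 0 <= w x * (- ln (cls f x)) by apply: Rmult_le_pos; lra.
lra.
Qed.

(** From ln t <= t - 1. Submodularity, the cardinality bound, Fano's and Jensen's inequalities below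
    are all instances, for suitable ratios [rho]. *)
Lemma gibbs (rho : Om -> R) : (forall x, 0 < w x -> 0 < rho x) ->
  \sum_x (w x * rho x) <= 1 -> \sum_x (w x * ln (rho x)) <= 0.
Proof.
move=> rho0 rho1.
apply: (Rle_trans _ (\sum_x (w x * rho x - w x))); last by rewrite sumRB w1; lra.
apply: sumR_le => x _; case: (w_split x) => [->|wx]; first lra.
have := Rmult_le_compat_l _ _ _ (Rlt_le _ _ wx) (ln_le_sub1 (rho0 x wx)); lra.
Qed.

Lemma sum_class_le1 (V : eqType) (f : Om -> V) (P : pred Om) :
  (forall x y, P x -> P y -> f x = f y) -> \sum_(x | P x) (w x / cls f x) <= 1.
Proof.
move=> fP; case: (pickP P) => [x0 Px0|P0]; last by rewrite big_pred0 //; lra.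
apply: (Rle_trans _ (\sum_(x | P x) (w x * / cls f x0))).
  by apply: sumR_le => x Px; rewrite (eq_cls (fP _ _ Px Px0)) /Rdiv; lra.
rewrite -mulR_suml.
have le : \sum_(x | P x) w x <= cls f x0.
  by apply: sumR_le_pred => // x Px; apply/eqP; apply: fP.
have [c0|c0] := Rle_lt_or_eq_dec _ _ (cls_ge0 f x0).
  by rewrite -(Rinv_r (cls f x0)); [apply: Rmult_le_compat_r => //; left; apply: Rinv_0_lt_compat | lra].
have -> : \sum_(x | P x) w x = 0 by have := sumR_ge0 (fun x (_ : P x) => w0 x); lra.
lra.
Qed.

Lemma div_cls_le1 (V : eqType) (f : Om -> V) x : w x / cls f x <= 1.
Proof.
case: (w_split x) => [->|wx]; first by rewrite /Rdiv Rmult_0_l; lra.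
have c0 := cls_gt0 f wx; rewrite -(Rinv_r (cls f x)); last lra.
apply: Rmult_le_compat_r (le_w_cls f x).
by left; apply: Rinv_0_lt_compat.
Qed.

Lemma div_cls_ge0 (V : eqType) (f : Om -> V) x : 0 <= w x / cls f x.
Proof.
case: (w_split x) => [->|wx]; first by rewrite /Rdiv Rmult_0_l; lra.
by left; apply: Rdiv_lt_0_compat => //; apply: cls_gt0.
Qed.

(** Nonnegativity of I(f;g|c) for a common function c of f and g: Gibbs' inequality for the ratio
    P(f) P(g) / (P(f,g) P(c)). *)
Lemma Ent_submod (U V W : eqType) (f : Om -> U) (g : Om -> V) (c : Om -> W) :
  refines f c -> refines g c ->
  Ent w (fun x => (f x, g x)) + Ent w c <= Ent w f + Ent w g.
Proof.
move=> fc gc; set fg := fun x => (f x, g x).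
pose rho x := cls f x * cls g x / (cls fg x * cls c x).
have rho0 x : 0 < w x -> 0 < rho x.
  by move=> wx; apply: Rdiv_lt_0_compat; apply: Rmult_lt_0_compat; exact: cls_gt0.
suff rho1 : \sum_x (w x * rho x) <= 1.
  have := gibbs rho0 rho1.
  have -> : \sum_x (w x * ln (rho x)) = \sum_x ((w x * ln (cls f x) + w x * ln (cls g x))
     - (w x * ln (cls fg x) + w x * ln (cls c x))).
    apply: eq_bigr => x _; case: (w_split x) => [->|wx]; first lra.
    have := cls_gt0 f wx; have := cls_gt0 g wx; have := cls_gt0 fg wx; have := cls_gt0 c wx.
    move=> *; rewrite /rho ln_div ?ln_mult //; try exact: Rmult_lt_0_compat.
    ring.
  rewrite sumRB !sumRD !EntE; lra.
have -> : \sum_x (w x * rho x) =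
    \sum_y \sum_z (w y * (w z * \sum_x (ind ((f x == f y) && (g x == g z)) *
       (w x / cls fg x * / cls c x)))).
  transitivity (\sum_x \sum_y \sum_z (w y * (w z * (ind ((f x == f y) && (g x == g z)) *
       (w x / cls fg x * / cls c x))))).
    apply: eq_bigr => x _.
    rewrite /rho /Rdiv Rinv_mult {1 2}/cls (sumR_ind (fun y => f x == f y)) (sumR_ind (fun y => g x == g y)).
    have -> a b s : w x * ((\sum_i a i) * (\sum_j b j) * s) =
        \sum_(i : Om) \sum_(j : Om) (w x * (a i * b j * s)).
      rewrite !mulR_suml mulR_sumr; apply: eq_bigr => i _.
      by rewrite mulR_sumr mulR_suml mulR_sumr.
    apply: eq_bigr => y _; apply: eq_bigr => z _.
    by case: (f x == f y) (g x == g z) => [] [] /=; lra.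
  rewrite exchange_sumR; apply: eq_bigr => y _.
  rewrite exchange_sumR; apply: eq_bigr => z _.
  by rewrite !mulR_sumr.
(* The classes of f and g have been expanded into points y and z. For fixed y and z, the x matching
   both lie in one class of [fg], so their conditional weights sum to at most 1, and c takes the
   same value at x, y and z. *)
apply: (Rle_trans _ (\sum_y \sum_z (w y * (w z * (ind (c y == c z) * / cls c y))))).
  apply: sumR_le => y _; apply: sumR_le => z _.
  do 2 (apply: Rmult_le_compat_l => //).
  apply: (Rle_trans _ (\sum_x (ind ((f x == f y) && (g x == g z)) * (w x / cls fg x) *
     (ind (c y == c z) * / cls c y)))).
    apply: sumR_le => x _.
    case: eqP => [/fc fxy|] /=; last lra.
    case: eqP => [/gc gxz|] /=; last lra.
    by rewrite -fxy gxz eqxx /= (eq_cls gxz) -(eq_cls (etrans (esym fxy) gxz)); lra.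
  rewrite -mulR_suml -sumR_ind.
  have : \sum_(x | (f x == f y) && (g x == g z)) (w x / cls fg x) <= 1.
    apply: sum_class_le1 => x x' /andP[/eqP e1 /eqP e2] /andP[/eqP e3 /eqP e4].
    by rewrite /fg e1 e2 e3 e4.
  have : 0 <= ind (c y == c z) * / cls c y.
    apply: Rmult_le_pos; first exact: ind_ge0.
    have [?|<-] := Rle_lt_or_eq_dec _ _ (cls_ge0 c y); last by rewrite Rinv_0; lra.
    by left; apply: Rinv_0_lt_compat.
  by move=> h1 h2; have := Rmult_le_compat_r _ _ _ h1 h2; lra.
rewrite -w1; apply: sumR_le => y _; rewrite -mulR_sumr.
rewrite -[X in _ <= X]Rmult_1_r; apply: Rmult_le_compat_l => //.
under eq_bigr => z _ do rewrite -Rmult_assoc.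
rewrite -mulR_suml.
have -> : \sum_z (w z * ind (c y == c z)) = cls c y.
  by rewrite /cls [RHS]sumR_ind; apply: eq_bigr => z _; lra.
have [?|<-] := Rle_lt_or_eq_dec _ _ (cls_ge0 c y); last by lra.
by rewrite Rinv_r; lra.
Qed.

Lemma Ent_pair_le (U V : eqType) (f : Om -> U) (g : Om -> V) :
  Ent w (fun x => (f x, g x)) <= Ent w f + Ent w g.
Proof.
have := @Ent_submod U V _ f g (fun=> tt) (fun _ _ _ => erefl) (fun _ _ _ => erefl).
by rewrite Ent_cst; lra.
Qed.

Lemma Ent_refines (U V : eqType) (f : Om -> U) (g : Om -> V) :
  refines f g -> Ent w g <= Ent w f.
Proof.
move=> fg; rewrite !EntE; apply: Ropp_le_contravar; apply: sumR_le => x _.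
case: (w_split x) => [->|wx]; first lra.
apply: Rmult_le_compat_l => //; apply: ln_le_mono; first exact: cls_gt0.
exact: cls_refines.
Qed.

Lemma Ent_le_ln_card (T : finType) (f : Om -> T) : Ent w f <= ln (INR #|T|).
Proof.
have T0 : 0 < INR #|T|.
  apply: (lt_INR 0); apply/ltP; rewrite lt0n; apply/eqP => T0.
  have : \sum_x w x = 0 by apply: big1 => x _; have := fintype0 (f x) T0.
  rewrite w1; lra.
have rho0 x : 0 < w x -> 0 < / (INR #|T| * cls f x).
  by move=> wx; apply: Rinv_0_lt_compat; apply: Rmult_lt_0_compat => //; apply: cls_gt0.
have rho1 : \sum_x (w x * / (INR #|T| * cls f x)) <= 1.
  have -> : \sum_x (w x * / (INR #|T| * cls f x)) =
            / INR #|T| * \sum_t \sum_(x | f x == t) (w x / cls f x).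
    have <- : \sum_x (w x / cls f x) = \sum_t \sum_(x | f x == t) (w x / cls f x).
      exact: (partition_big f predT).
    rewrite mulR_sumr; apply: eq_bigr => x _.
    by rewrite Rinv_mult /Rdiv; lra.
  have le : \sum_t \sum_(x | f x == t) (w x / cls f x) <= \sum_(t : T) 1.
    by apply: sumR_le => t _; apply: sum_class_le1 => x y /eqP -> /eqP ->.
  rewrite sumR_const Rmult_1_r in le.
  have := Rmult_le_compat_l _ _ _ (Rlt_le _ _ (Rinv_0_lt_compat _ T0)) le.
  by rewrite Rinv_l; lra.
have := gibbs rho0 rho1.
have -> : \sum_x (w x * ln (/ (INR #|T| * cls f x))) =
          \sum_x (w x * - ln (INR #|T|) - w x * ln (cls f x)).
  apply: eq_bigr => x _; case: (w_split x) => [->|wx]; first lra.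
  have c0 := cls_gt0 f wx.
  by rewrite ln_Rinv ?ln_mult //; [lra | apply: Rmult_lt_0_compat].
by rewrite sumRB -mulR_suml w1 EntE; lra.
Qed.

(* Gibbs' inequality against the conditional law giving mass 1/2 to the event
   [U = V] and spreading the rest uniformly over at most [#|Om|] values. *)
Lemma fano (V : eqType) (f g : Om -> V) :
  Ent w (fun x => (f x, g x)) - Ent w g <=
  ln 2 + Prob w (fun x => f x != g x) * ln (INR #|Om|).
Proof.
set fg := fun x => (f x, g x).
have N0 : 0 < INR #|Om|.
  apply: (lt_INR 0); apply/ltP; rewrite lt0n; apply/eqP => T0.
  have : \sum_x w x = 0 by apply: big1 => x _; have := fintype0 x T0.
  rewrite w1; lra.
pose iN := / INR #|Om|; have iN0 : 0 < iN := Rinv_0_lt_compat _ N0.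
have NiN : INR #|Om| * iN = 1 by apply: Rinv_r; lra.
have lniN : ln iN = - ln (INR #|Om|) by apply: ln_Rinv.
pose q x := / 2 * (if f x == g x then 1 else iN).
have q0 x : 0 < q x by rewrite /q; case: eqP => _; lra.
pose rho x := q x * (cls g x / cls fg x).
have rho0 x : 0 < w x -> 0 < rho x.
  by move=> wx; apply: Rmult_lt_0_compat => //; apply: Rdiv_lt_0_compat; apply: cls_gt0.
have rho1 : \sum_x (w x * rho x) <= 1.
  have -> : \sum_x (w x * rho x) =
    \sum_y (w y * \sum_x (ind (g x == g y) * (q x * (w x / cls fg x)))).
    transitivity (\sum_x \sum_y (w y * (ind (g x == g y) * (q x * (w x / cls fg x))))).
      apply: eq_bigr => x _; rewrite /rho {1}/cls (sumR_ind (fun y => g x == g y)) /Rdiv mulR_suml !mulR_sumr.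
      by apply: eq_bigr => y _; lra.
    by rewrite exchange_sumR; apply: eq_bigr => y _; rewrite mulR_sumr.
  rewrite -w1; apply: sumR_le => y _.
  rewrite -[X in _ <= X]Rmult_1_r; apply: Rmult_le_compat_l => //.
  apply: (Rle_trans _ (\sum_x (/ 2 * (ind ((g x == g y) && (f x == g y)) * (w x / cls fg x))
     + / 2 * iN))).
    apply: sumR_le => x _.
    have h0 := div_cls_ge0 fg x; have h1 := div_cls_le1 fg x.
    move: (w x / _) h0 h1 => u h0 h1; rewrite /q.
    case: (g x =P g y) => [<-|_] /=; last by rewrite !Rmult_0_l; lra.
    case: (f x =P g x) => _ /=; first lra.
    by have := Rmult_le_compat_r _ _ _ (Rlt_le _ _ iN0) h1; lra.
  rewrite sumRD sumR_const -mulR_sumr -sumR_ind.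
  have : \sum_(x | (g x == g y) && (f x == g y)) (w x / cls fg x) <= 1.
    apply: sum_class_le1 => x x' /andP[/eqP e1 /eqP e2] /andP[/eqP e3 /eqP e4].
    by rewrite /fg e1 e2 e3 e4.
  have -> : INR #|Om| * (/ 2 * iN) = / 2 by rewrite Rmult_comm Rmult_assoc [iN * _]Rmult_comm NiN; lra.
  by move=> ?; lra.
have := gibbs rho0 rho1.
have -> : \sum_x (w x * ln (rho x)) =
    \sum_x ((w x * ln (cls g x) - w x * ln (cls fg x)) +
            (w x * - ln 2 + (ind (f x != g x) * w x) * - ln (INR #|Om|))).
  apply: eq_bigr => x _; case: (w_split x) => [->|wx]; first lra.
  have c1 := cls_gt0 g wx; have c2 := cls_gt0 fg wx.
  rewrite /rho ln_mult // ?ln_div //; last exact: Rdiv_lt_0_compat.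
  have -> : ln (q x) = - ln 2 + ind (f x != g x) * - ln (INR #|Om|).
    have ln2 : ln (/ 2) = - ln 2 by apply: ln_Rinv; lra.
    by rewrite -lniN /q; case: eqP => _ /=; [rewrite Rmult_1_r | rewrite ln_mult //; last lra]; lra.
  ring.
rewrite sumRD sumRB sumRD -!mulR_suml w1 !EntE /Prob /finRsum.
rewrite (sumR_ind (fun x => f x != g x) w); lra.
Qed.

End Entropy.

(** * Product measures and exponential decay *)

Lemma ln_prodR n (F : 'I_n -> R) : (forall k, 0 < F k) ->
  0 < \prod_(k < n) F k /\ ln (\prod_(k < n) F k) = \sum_(k < n) ln (F k).
Proof.
move=> F0; apply: (big_rec2 (fun a b => 0 < a /\ ln a = b)) => [|k y z _ [y0 <-]].
  by rewrite ln_1; split=> //; lra.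
by split; [exact: Rmult_lt_0_compat | rewrite ln_mult].
Qed.

Lemma prodR_pow n c : \prod_(k < n) c = c ^ n.
Proof. by rewrite big_const card_ord; elim: n => //= n ->. Qed.

(** Multiplied by 1 - t, the left side is at most exp t * exp (- t) = 1 and the right side is 1 +
    t^2 (1 - 2 t). The range includes all negative t, so that exponents have to be bounded from
    above only. *)
Lemma exp_le_quadratic t : t <= / 2 -> exp t <= 1 + t + 2 * t * t.
Proof.
move=> t2; have e1 : exp t * exp (- t) = 1 by rewrite -exp_plus Rplus_opp_r exp_0.
have e2 := exp_ineq1_le (- t); have e3 := exp_pos t.
have h : 1 <= (1 + t + 2 * t * t) * (1 - t).
  have : 0 <= t * t * (1 - 2 * t) by apply: Rmult_le_pos; [exact: Rle_0_sqr | lra].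
  lra.
have e4 : exp t * (1 - t) <= 1 by rewrite -e1; apply: Rmult_le_compat_l; lra.
apply: (Rmult_le_reg_r (1 - t)); lra.
Qed.

(** For z <= 0, ln (1 + u) <= u and z <= s * z. For z > 0, the left side is at most 1 + z and the
    right side at least 1 / s + z. *)
Lemma ln1Dexp_le s z : 0 < s -> s <= 1 -> ln (1 + exp z) <= exp (s * z) / s.
Proof.
move=> s0 s1; have ez := exp_pos z.
have is1 : 1 <= / s by rewrite -[X in X <= _]Rinv_1; apply: Rinv_le_contravar.
case: (Rle_or_lt z 0) => z0.
  have h1 : ln (1 + exp z) <= exp z by have := @ln_le_sub1 (1 + exp z); lra.
  have h2 : exp z <= exp (s * z).
    have : z <= s * z by have := Rmult_le_compat_neg_l z s 1 z0 s1; lra.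
    by case=> [lt|<-]; [left; exact: exp_increasing | lra].
  have h3 : exp (s * z) * 1 <= exp (s * z) * / s.
    by apply: Rmult_le_compat_l => //; left; exact: exp_pos.
  rewrite /Rdiv; lra.
have h1 : ln (1 + exp z) <= 1 + z.
  have e0 : 1 < exp z by rewrite -exp_0; exact: exp_increasing.
  apply: (Rle_trans _ (ln (exp 1 * exp z))).
    apply: ln_le_mono; first lra.
    have := exp_ineq1_le 1 => ?.
    have := Rmult_le_compat_r (exp z) 2 (exp 1); lra.
  by rewrite -exp_plus ln_exp; lra.
have h2 : (1 + s * z) * / s <= exp (s * z) * / s.
  apply: Rmult_le_compat_r; last exact: exp_ineq1_le.
  by left; exact: Rinv_0_lt_compat.
have h3 : (1 + s * z) * / s = / s + z by field; lra.
rewrite /Rdiv; lra.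
Qed.

Section ProductMeasure.
Variables (T : finType) (P : T -> R).
Hypotheses (P0 : forall t, 0 <= P t) (P1 : \sum_t P t = 1).

(** At [Sample X] this is convertible to [Pn], and the block observed by a terminal is a [pointwise]
    image; the general lemmas apply to the source in this way. *)
Definition iid n (x : {ffun 'I_n -> T}) : R := \prod_(k < n) P (x k).

Definition pointwise n (V : Type) (f : T -> V) (x : {ffun 'I_n -> T}) : {ffun 'I_n -> V} :=
  [ffun k => f (x k)].

Lemma sum_prodR n (phi : 'I_n -> T -> R) :
  \sum_(x : {ffun 'I_n -> T}) \prod_(k < n) phi k (x k) = \prod_(k < n) \sum_t phi k t.
Proof. by rewrite bigA_distr_bigA. Qed.

Lemma iid_ge0 n (x : {ffun 'I_n -> T}) : 0 <= iid x.
Proof. by apply: big_ind => //; [lra | exact: Rmult_le_pos]. Qed.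

Lemma iid_sum1 n : \sum_(x : {ffun 'I_n -> T}) iid x = 1.
Proof. by rewrite (sum_prodR (fun=> P)); rewrite -[RHS](pow1 n) -prodR_pow; apply: eq_bigr => k _; exact: P1. Qed.

Lemma iid_gt0 n (x : {ffun 'I_n -> T}) k : 0 < iid x -> 0 < P (x k).
Proof.
rewrite /iid (bigD1 k) //= => x0.
have [//|e] := Rle_lt_or_eq_dec _ _ (P0 (x k)).
by move: x0; rewrite -e Rmult_0_l; lra.
Qed.

Lemma iid_prod n (psi : T -> R) :
  \sum_(x : {ffun 'I_n -> T}) (iid x * \prod_(k < n) psi (x k)) = (\sum_t (P t * psi t)) ^ n.
Proof.
rewrite -prodR_pow -(sum_prodR (fun _ t => P t * psi t)); apply: eq_bigr => x _.
by rewrite /iid -big_split.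
Qed.

Lemma iid_coordinate n (psi : T -> R) (k : 'I_n) :
  \sum_(x : {ffun 'I_n -> T}) (iid x * psi (x k)) = \sum_t (P t * psi t).
Proof.
have -> : \sum_(x : {ffun 'I_n -> T}) (iid x * psi (x k)) =
    \sum_(x : {ffun 'I_n -> T}) \prod_(j < n) (P (x j) * (if j == k then psi (x j) else 1)).
  apply: eq_bigr => x _; rewrite big_split; congr (_ * _).
  rewrite (bigD1 k) //= eqxx big1 ?Rmult_1_r // => j /negbTE ->.
  by [].
rewrite (sum_prodR (fun j t => P t * (if j == k then psi t else 1))).
rewrite (bigD1 k) //= eqxx [X in _ * X]big1 ?Rmult_1_r // => j /negbTE ->.
by rewrite -[RHS]P1; apply: eq_bigr => t _; lra.
Qed.

Lemma cls_iid n (V : eqType) (f : T -> V) (x : {ffun 'I_n -> T}) :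
  cls (@iid n) (pointwise f) x = \prod_(k < n) cls P f (x k).
Proof.
rewrite /cls.
under [RHS]eq_bigr => k _ do rewrite (sumR_ind (fun y => f (x k) == f y)).
rewrite -sum_prodR (sumR_ind (fun y => pointwise f x == pointwise f y)).
apply: eq_bigr => y _; rewrite /iid big_split; congr (_ * _).
case: eqP => [e|ne] /=.
  by rewrite big1 // => k _; move/ffunP/(_ k): e; rewrite !ffunE => ->; rewrite eqxx.
case: (pickP (fun k => f (x k) != f (y k))) => [k /negbTE nk|all].
  by rewrite (bigD1 k) //= nk Rmult_0_l.
case: ne; apply/ffunP => k; rewrite !ffunE; apply/eqP.
by move: (all k) => /negbFE.
Qed.

Lemma Ent_iid n (V : eqType) (f : T -> V) :
  Ent (@iid n) (pointwise f) = INR n * Ent P f.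
Proof.
rewrite !EntE.
have -> : \sum_(x : {ffun 'I_n -> T}) (iid x * ln (cls (@iid n) (pointwise f) x)) =
   \sum_(k < n) \sum_(x : {ffun 'I_n -> T}) (iid x * ln (cls P f (x k))).
  rewrite exchange_sumR; apply: eq_bigr => x _; rewrite -mulR_sumr.
  have [<-|x0] := Req_dec 0 (iid x); first by rewrite !Rmult_0_l.
  have {}x0 : 0 < iid x by have := iid_ge0 x; lra.
  rewrite cls_iid; congr (_ * _); apply: (proj2 (ln_prodR _)) => k.
  exact: cls_gt0 (iid_gt0 k x0).
rewrite [X in - X = _](eq_bigr (fun=> \sum_x (P x * ln (cls P f x)))); last first.
  by move=> k _; exact: (iid_coordinate (fun t => ln (cls P f t)) k).
by rewrite sumR_const card_ord; lra.
Qed.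

Lemma pointwise_pair n (U V : eqType) (f : T -> U) (g : T -> V) (x y : {ffun 'I_n -> T}) :
  (pointwise (fun t => (f t, g t)) x = pointwise (fun t => (f t, g t)) y) <->
  ((pointwise f x, pointwise g x) = (pointwise f y, pointwise g y)).
Proof.
split=> [/ffunP e|[/ffunP e1 /ffunP e2]].
  by congr (_, _); apply/ffunP => k; move: (e k); rewrite !ffunE => -[].
by apply/ffunP => k; move: (e1 k) (e2 k); rewrite !ffunE => -> ->.
Qed.

Lemma MI_iid n (U V : eqType) (f : T -> U) (g : T -> V) :
  MI (@iid n) (pointwise f) (pointwise g) = INR n * MI P f g.
Proof.
rewrite /MI Rmult_minus_distr_l Rmult_plus_distr_l -!Ent_iid; congr (_ - _).
by apply: Ent_kernel => x y /pointwise_pair.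
Qed.

Lemma mean_exp_lt1 (Z : T -> R) : \sum_t (P t * Z t) < 0 ->
  exists s, 0 < s <= 1 /\ \sum_t (P t * exp (s * Z t)) < 1.
Proof.
set mu := \sum_t _ => mu0.
pose Q := \sum_t (P t * (Z t * Z t)); pose B := 1 + \sum_t Rabs (Z t).
have Q0 : 0 <= Q by apply: sumR_ge0 => t _; apply: Rmult_le_pos => //; exact: Rle_0_sqr.
have ZB t : Z t <= B.
  have zt : Rabs (Z t) <= \sum_t Rabs (Z t).
    exact: (@sumR_term _ predT (fun t => Rabs (Z t)) t (fun _ => Rabs_pos _) isT).
  by have := Rle_abs (Z t); rewrite /B; lra.
have B1 : 1 <= B.
  have : 0 <= \sum_t Rabs (Z t) by apply: sumR_ge0 => t _; exact: Rabs_pos.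
  by rewrite /B; lra.
(* The first bound keeps s * Z below 1/2, where the quadratic estimate applies. The second makes the
   quadratic term 2 * s^2 * Q strictly smaller than - s * mu; the + 1 gives strictness and covers Q
   = 0. *)
pose s := Rmin (/ (2 * B)) (- mu / (2 * (Q + 1))).
have s0 : 0 < s by apply: Rmin_glb_lt; [apply: Rinv_0_lt_compat | apply: Rdiv_lt_0_compat]; lra.
have sB : s * B <= / 2.
  have -> : / 2 = / (2 * B) * B by field; lra.
  by apply: Rmult_le_compat_r; [lra | exact: Rmin_l].
have sQ : 2 * s * (Q + 1) <= - mu.
  have -> : - mu = - mu / (2 * (Q + 1)) * (2 * (Q + 1)) by field; lra.
  have -> : 2 * s * (Q + 1) = s * (2 * (Q + 1)) by ring.
  by apply: Rmult_le_compat_r; [lra | exact: Rmin_r].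
have s1 : s <= 1 by have := Rmult_le_compat_l s 1 B (Rlt_le _ _ s0) B1; lra.
exists s; split; first lra.
apply: (Rle_lt_trans _ (\sum_t (P t + s * (P t * Z t) + 2 * (s * s) * (P t * (Z t * Z t))))).
  apply: sumR_le => t _.
  have sZ : s * Z t <= / 2 by have := Rmult_le_compat_l s _ _ (Rlt_le _ _ s0) (ZB t); lra.
  by have := Rmult_le_compat_l _ _ _ (P0 t) (exp_le_quadratic sZ); lra.
rewrite !sumRD -!mulR_sumr P1 -/mu -/Q.
have h : 2 * s * Q < - mu by lra.
by have := Rmult_lt_compat_l s _ _ s0 h; lra.
Qed.

(** The term added to 1 is C times the exponential of a sum of i.i.d. variables of mean r - H(f1) +
    H(f2). Every error term of the coding scheme has this form: r is a sum of rates up to sign, and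
    C absorbs the rounding of the alphabet sizes. *)
Lemma iid_ln_vanish (V1 V2 : eqType) (f1 : T -> V1) (f2 : T -> V2) (C r delta : R) :
  1 <= C -> r - Ent P f1 + Ent P f2 < 0 -> 0 < delta ->
  exists N, forall n, (N <= n)%N ->
    \sum_(x : {ffun 'I_n -> T}) (iid x *
       ln (1 + C * exp (INR n * r) * cls (@iid n) (pointwise f1) x
                                    / cls (@iid n) (pointwise f2) x)) <= delta.
Proof.
move=> C1 neg delta0.
pose Z t := r + ln (cls P f1 t) - ln (cls P f2 t).
have /mean_exp_lt1 [s [[s0 s1] rho1]] : \sum_t (P t * Z t) < 0.
  have -> : \sum_t (P t * Z t) =
     \sum_t (P t * r + P t * ln (cls P f1 t) - P t * ln (cls P f2 t)).
    by apply: eq_bigr => t _; rewrite /Z; ring.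
  by rewrite sumRB sumRD -mulR_suml P1; move: neg; rewrite !EntE; lra.
set rho := \sum_t _ in rho1.
have rho0 : 0 <= rho.
  by apply: sumR_ge0 => t _; apply: Rmult_le_pos => //; left; exact: exp_pos.
have dC : 0 < delta * (s / C) by apply: Rmult_lt_0_compat => //; apply: Rdiv_lt_0_compat; lra.
have [|N hN] := @pow_lt_1_zero rho _ _ dC; first by rewrite Rabs_pos_eq.
exists N => n /leP/hN; rewrite Rabs_pos_eq; last exact: pow_le.
move=> rn; apply: (Rle_trans _ (C / s * rho ^ n)); last first.
  have -> : delta = C / s * (delta * (s / C)) by field; lra.
  by apply: Rmult_le_compat_l; [left; apply: Rdiv_lt_0_compat; lra | lra].
rewrite -iid_prod mulR_sumr; apply: sumR_le => x _.
have [<-|x0] := Req_dec 0 (iid x); first by rewrite !Rmult_0_l Rmult_0_r; lra.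
have {}x0 : 0 < iid x by have := iid_ge0 x; lra.
have c1 k : 0 < cls P f1 (x k) := cls_gt0 P0 f1 (iid_gt0 k x0).
have c2 k : 0 < cls P f2 (x k) := cls_gt0 P0 f2 (iid_gt0 k x0).
have [p1 l1] := ln_prodR c1; have [p2 l2] := ln_prodR c2.
rewrite !cls_iid; pose z := \sum_(k < n) Z (x k).
have zE : z = INR n * r + ln (\prod_(k < n) cls P f1 (x k)) - ln (\prod_(k < n) cls P f2 (x k)).
  by rewrite l1 l2 /z sumRB sumRD sumR_const card_ord.
have -> : C * exp (INR n * r) * \prod_(k < n) cls P f1 (x k) / \prod_(k < n) cls P f2 (x k)
     = exp (ln C + z).
  rewrite zE !exp_plus exp_Ropp !exp_ln //; last lra.
  by rewrite /Rdiv; ring.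
have -> : \prod_(k < n) exp (s * Z (x k)) = exp (s * z).
  rewrite /z mulR_sumr; elim/big_ind2: _ => //; first by rewrite exp_0.
  by move=> a b c d -> ->; rewrite exp_plus.
have -> : C / s * (iid x * exp (s * z)) = iid x * (C * exp (s * z) / s) by rewrite /Rdiv; ring.
apply: Rmult_le_compat_l; first lra.
apply: (Rle_trans _ _ _ (ln1Dexp_le _ s0 s1)).
apply: Rmult_le_compat_r; first by left; exact: Rinv_0_lt_compat.
rewrite Rmult_plus_distr_l exp_plus; apply: Rmult_le_compat_r; first by left; exact: exp_pos.
rewrite -[X in _ <= X](exp_ln C); last lra.
have lC : 0 <= ln C by rewrite -ln_1; apply: ln_le_mono; lra.
have : s * ln C <= ln C by have := Rmult_le_compat_r _ _ _ lC s1; lra.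
by case=> [?|->]; [left; exact: exp_increasing | lra].
Qed.

End ProductMeasure.

(** * Conditional mutual information and the entropy of a key *)

Section Conditional.
Variables (Om : finType) (w : Om -> R).
Hypotheses (w0 : forall x, 0 <= w x) (w1 : \sum_x w x = 1).

Lemma Ent_submod_le (U V W Z : eqType) (f : Om -> U) (g : Om -> V) (c : Om -> W) (h : Om -> Z) :
  refines f c -> refines g c -> (forall x y, f x = f y -> g x = g y -> h x = h y) ->
  Ent w h + Ent w c <= Ent w f + Ent w g.
Proof.
move=> fc gc fgh; have := Ent_submod w0 w1 fc gc.
have : Ent w h <= Ent w (fun x => (f x, g x)).
  by apply: Ent_refines => // x y [? ?]; apply: fgh.
lra.
Qed.

Definition cmi (U V W : eqType) (f : Om -> U) (g : Om -> V) (c : Om -> W) : R :=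
  Ent w (fun x => (f x, c x)) + Ent w (fun x => (g x, c x))
  - Ent w (fun x => (f x, g x, c x)) - Ent w c.

(** Here c' amounts to c and a message computed from f and c, whence I(f;g|c') = I(f;g|c) -
    I(c';g|c), and the last term is nonnegative. *)
Lemma cmi_stepl (U V W W' : eqType) (f : Om -> U) (g : Om -> V) (c : Om -> W) (c' : Om -> W') :
  refines c' c -> refines (fun x => (f x, c x)) c' -> cmi f g c' <= cmi f g c.
Proof.
move=> c'c fc'; rewrite /cmi.
have h1 : Ent w (fun x => (f x, c' x)) <= Ent w (fun x => (f x, c x)).
  by apply: Ent_refines => // x y [e1 e2]; congr (_, _) => //; apply: fc'; rewrite /= e1 e2.
have h2 : Ent w (fun x => (f x, g x, c x)) <= Ent w (fun x => (f x, g x, c' x)).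
  by apply: Ent_refines => // x y [e1 e2 e3]; rewrite e1 e2 (c'c _ _ e3).
have h3 : Ent w (fun x => (g x, c' x)) + Ent w c <= Ent w (fun x => (g x, c x)) + Ent w c'.
  by apply: Ent_submod_le => // [x y []//|x y [-> _] ->].
lra.
Qed.

Lemma cmiC (U V W : eqType) (f : Om -> U) (g : Om -> V) (c : Om -> W) : cmi f g c = cmi g f c.
Proof.
rewrite /cmi.
have -> : Ent w (fun x => (f x, g x, c x)) = Ent w (fun x => (g x, f x, c x)).
  by apply: Ent_kernel => x y [-> -> ->].
lra.
Qed.

Lemma cmi_stepr (U V W W' : eqType) (f : Om -> U) (g : Om -> V) (c : Om -> W) (c' : Om -> W') :
  refines c' c -> refines (fun x => (g x, c x)) c' -> cmi f g c' <= cmi f g c.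
Proof. by move=> *; rewrite ![cmi f g _]cmiC; apply: cmi_stepl. Qed.

Lemma cmi_cst (U V W : eqType) (f : Om -> U) (g : Om -> V) (v : W) :
  cmi f g (fun=> v) = MI w f g.
Proof.
rewrite /cmi /MI (Ent_cst w1).
have -> : Ent w (fun x => (f x, v)) = Ent w f by apply: Ent_kernel => x y; [case | move=> ->].
have -> : Ent w (fun x => (g x, v)) = Ent w g by apply: Ent_kernel => x y; [case | move=> ->].
have -> : Ent w (fun x => (f x, g x, v)) = Ent w (fun x => (f x, g x)).
  by apply: Ent_kernel => x y; case=> -> ->.
lra.
Qed.

Lemma Prob_setC (E : pred Om) : Prob w E + Prob w (fun x => ~~ E x) = 1.
Proof. by rewrite -w1 /Prob /finRsum [RHS](bigID E). Qed.

(* [f], [g] are the observations of two talking terminals, [F] the public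
   transcript and [Jf], [Jg] the two estimates of the key [K]. *)
Lemma key_entropy_le (U V W N : eqType) (f : Om -> U) (g : Om -> V) (F : Om -> W)
    (K Jf Jg : Om -> N) :
  refines (fun x => (g x, F x)) Jg -> refines (fun x => (f x, F x)) Jf ->
  Ent w K - MI w K F <=
  cmi f g F + (ln 2 + Prob w (fun x => K x != Jf x) * ln (INR #|Om|))
            + (ln 2 + Prob w (fun x => Jf x != Jg x) * ln (INR #|Om|)).
Proof.
move=> gJ fJ.
have fano1 := fano w0 w1 K Jf; have fano2 := fano w0 w1 Jf Jg.
(* The left side of the goal is H(K|F). In conditional form the three bounds are H(K|F) <= H(Jf|F) +
   H(K|Jf), then H(Jf|F) <= I(f;g|F) + H(Jf|g,F), then H(Jf|g,F) <= H(Jf|Jg); Fano bounds H(K|Jf)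
   and H(Jf|Jg). *)
have h1 : Ent w (fun x => (K x, F x)) + Ent w Jf <=
    Ent w (fun x => (Jf x, F x)) + Ent w (fun x => (K x, Jf x)).
  by apply: Ent_submod_le => [x y []|x y []|x y [_ ->] [->]].
have h2 : Ent w (fun x => (f x, g x, F x)) + Ent w (fun x => (Jf x, F x)) <=
    Ent w (fun x => (f x, F x)) + Ent w (fun x => (Jf x, (g x, F x))).
  apply: Ent_submod_le => [x y e|x y [-> _ ->]|x y [-> _] [_ -> ->]] //.
  by rewrite (fJ _ _ e); case: e => _ ->.
have h3 : Ent w (fun x => (Jf x, (g x, F x))) + Ent w Jg <=
    Ent w (fun x => (g x, F x)) + Ent w (fun x => (Jf x, Jg x)).
  by apply: Ent_submod_le => [//|x y []|x y [-> ->] [->]].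
rewrite /MI /cmi; lra.
Qed.

End Conditional.

(** * Converse: two talkers cannot exceed their mutual information *)

Section Converse.
Variables (X : 'I_3 -> finType) (P : Sample X -> R).
Hypotheses (P0 : forall x, 0 <= P x) (P1 : \sum_x P x = 1).

Definition coord (i : 'I_3) (x : Sample X) : X i := x i.
Definition obs (i : 'I_3) n (x : SampleN X n) : {ffun 'I_n -> X i} := pointwise (coord i) x.

Lemma agree_obs i n (x y : SampleN X n) : agree_i i x y = (obs i x == obs i y).
Proof.
apply/forallP/eqP => [e|/ffunP e k].
  by apply/ffunP => k; rewrite !ffunE; apply/eqP; exact: e.
by move: (e k); rewrite !ffunE => /eqP.
Qed.

Lemma Pn_ge0 n (x : SampleN X n) : 0 <= Pn P x.
Proof. exact: iid_ge0. Qed.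

Lemma Pn_sum1 n : \sum_x @Pn X P n x = 1.
Proof. exact: iid_sum1. Qed.

(** The transcript so far is a function of the data, so the induction can move each transmission
    into the conditioning variable. A message depends only on its sender's observation and on the
    past, so one of the two step lemmas applies. *)
Lemma cmi_run n (a b : 'I_3) (p : protocol X n) (prev : SampleN X n -> seq nat) :
  valid_protocol p -> only_from [set a; b] p ->
  cmi (@Pn X P n) (@obs a n) (@obs b n) (fun x => run p (prev x) x) <=
  cmi (@Pn X P n) (@obs a n) (@obs b n) prev.
Proof.
elim: p prev => [|t p IH] prev; first by move=> *; exact: Rle_refl.
move=> /List.Forall_cons_iff[lt vp] /List.Forall_cons_iff[tab op].
apply: Rle_trans (IH (fun x => rcons (prev x) (t.2 (prev x) x)) vp op) _.
have r1 : refines (fun x => rcons (prev x) (t.2 (prev x) x)) prev.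
  by move=> x y /rcons_inj[].
have r2 (i : 'I_3) : t.1 = i ->
    refines (fun x => (obs i x, prev x)) (fun x => rcons (prev x) (t.2 (prev x) x)).
  move=> ti x y [e1 e2]; rewrite e2; congr rcons.
  by apply: lt; rewrite ti agree_obs e1.
case/set2P: tab => [/r2|/r2]; [exact: cmi_stepl (@Pn_ge0 n) (Pn_sum1 n) _ _ _ _ _ _ _ _ r1
  | exact: cmi_stepr (@Pn_ge0 n) (Pn_sum1 n) _ _ _ _ _ _ _ _ r1].
Qed.

Lemma ln_card_SampleN n : ln (INR #|SampleN X n|) = INR n * ln (INR #|Sample X|).
Proof.
have T0 : 0 < INR #|Sample X|.
  apply: (lt_INR 0); apply/ltP; rewrite lt0n; apply/eqP => T0.
  have : \sum_x P x = 0 by apply: big1 => x _; have := fintype0 x T0.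
  rewrite P1; lra.
have -> : INR #|SampleN X n| = \prod_(k < n) INR #|Sample X|.
  rewrite card_ffun card_ord prodR_pow; elim: n => //= n <-.
  by rewrite expnS mult_INR.
by rewrite (proj2 (ln_prodR _)) // sumR_const card_ord.
Qed.

Lemma rate_le_MI (a b : 'I_3) (r : R) :
  sk_achievable_T P [set a; b] r -> r <= MI P (coord a) (coord b).
Proof.
case=> F [K [vF [cr rate]]]; apply: le_epsilon => eta eta0.
set I0 := MI _ _ _; pose M := ln (INR #|Sample X|).
have M0 : 0 <= M by apply: Rle_trans (Ent_le_ln_card P0 P1 id); exact: Ent_ge0.
(* Per symbol, Fano costs 2 * eps * M and the rate condition eps, together at most eta / 2. The
   constant terms stay below 1 + 2 * ln 2 and take the other eta / 2 once n exceeds [N3]. *)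
pose eps := Rmin (/ 2) (eta / 2 / (1 + 2 * M)).
have eps0 : 0 < eps by apply: Rmin_glb_lt; [lra | do 2 (apply: Rdiv_lt_0_compat; last lra)].
have eps1 : eps <= / 2 by exact: Rmin_l.
have epsM : eps * (1 + 2 * M) <= eta / 2.
  have -> : eta / 2 = eta / 2 / (1 + 2 * M) * (1 + 2 * M) by field; lra.
  by apply: Rmult_le_compat_r; [lra | exact: Rmin_r].
have [N1 h1] := cr eps (conj eps0 (ltac:(lra) : eps < 1)).
have [N2 h2] := rate eps eps0.
have [N3 h3] := @INR_archimed (eta / 2) (1 + 2 * ln 2) (ltac:(lra)).
pose n := (N1 + N2 + N3.+1)%N.
have [Ji [loc prJ]] : _ := h1 n (leq_trans (leq_addr N2 _) (leq_addr _ _)).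
have [mi rt] := h2 n (leq_trans (leq_addl N1 _) (leq_addr _ _)).
have n0 : 0 < INR n by rewrite /n addnS; apply: lt_0_INR; apply/ltP.
have nN : INR N3 <= INR n by apply: le_INR; apply/leP; rewrite /n addnS -addSn leq_addl.
have rf i : refines (fun x : SampleN X n => (obs i x, transcript (F n) x)) (Ji i).
  by move=> x y [e1 e2]; apply: loc => //; rewrite agree_obs e1.
have key := key_entropy_le (@Pn_ge0 n) (Pn_sum1 n) (K n) (rf b) (rf a).
have p0 := Prob_setC (Pn_sum1 n) (fun x => [forall i, Ji i x == K n x]).
have pr (E : pred (SampleN X n)) :
    (forall x, E x -> ~~ [forall i, Ji i x == K n x]) -> Prob (@Pn X P n) E <= eps.
  move=> sub; apply: (Rle_trans _ (Prob (@Pn X P n) (fun x => ~~ [forall i, Ji i x == K n x]))).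
    by apply: sumR_le_pred => //; exact: Pn_ge0.
  lra.
have pr1 : Prob (@Pn X P n) (fun x => K n x != Ji a x) <= eps.
  by apply: pr => x; apply: contra => /forallP/(_ a); rewrite eq_sym.
have pr2 : Prob (@Pn X P n) (fun x => Ji a x != Ji b x) <= eps.
  apply: pr => x; apply: contra => /forallP h.
  by rewrite (eqP (h a)) (eqP (h b)).
have cm : cmi (@Pn X P n) (@obs a n) (@obs b n) (transcript (F n)) <= INR n * I0.
  have [v o] := vF n; apply: Rle_trans (cmi_run (fun=> [::]) v o) _.
  by rewrite (cmi_cst (Pn_sum1 n)) (MI_iid P0 P1 n (coord a) (coord b)); exact: Rle_refl.
rewrite !ln_card_SampleN -/M in key.
have nM0 : 0 <= INR n * M by apply: Rmult_le_pos; lra.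
have k1 := Rmult_le_compat_r _ _ _ nM0 pr1; have k2 := Rmult_le_compat_r _ _ _ nM0 pr2.
have Kn : Ent (@Pn X P n) (K n) = Ent (@Pn X P n) (K n) / INR n * INR n by field; lra.
have rt' := Rmult_le_compat_r (INR n) _ _ (Rlt_le _ _ n0) (Rge_le _ _ rt).
have e1 := Rmult_le_compat_l _ _ _ (Rlt_le _ _ n0) epsM.
have e2 := Rmult_le_compat_r (eta / 2) _ _ (ltac:(lra)) nN.
apply: (Rmult_le_reg_r (INR n)) => //; lra.
Qed.

(** Silence and a constant key. It makes the set of achievable rates nonempty, so that a bounded one
    has a supremum, and this supremum nonnegative. *)
Lemma zero_rate_achievable (T : {set 'I_3}) (r : R) : r <= 0 -> sk_achievable_T P T r.
Proof.
move=> r0; exists (fun=> [::]), (fun _ _ => 0%N); split; [by split; exact: List.Forall_nil | split].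
  move=> eps [eps0 _]; exists 0%N => n _; exists (fun _ _ => 0%N); split=> //.
  rewrite /Prob /finRsum (eq_bigl predT) ?(Pn_sum1 n); first lra.
  by move=> x; apply/forallP.
move=> eps eps0; exists 0%N => n _; rewrite /MI.
have -> : Ent (@Pn X P n) (transcript [::]) = 0 := Ent_cst (Pn_sum1 n) [::].
have -> : Ent (@Pn X P n) (fun x => (0%N, transcript [::] x)) = 0.
  by rewrite -(Ent_cst (Pn_sum1 n) tt); apply: Ent_kernel.
have -> : Ent (@Pn X P n) (fun=> 0%N) = 0 := Ent_cst (Pn_sum1 n) 0%N.
by rewrite /Rdiv Rmult_0_l; lra.
Qed.

End Converse.

(** * Uniform random hashes and averages over them *)

Lemma sumR_pair (S T : finType) (F : S -> T -> R) :
  \sum_(p : S * T) F p.1 p.2 = \sum_s \sum_t F s t.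
Proof. by rewrite pair_big. Qed.

Section RandomHash.
Variables S V : finType.
Hypothesis V0 : 0 < INR #|V|.

Let iV : R := / INR #|V|.
Let VK : \sum_(v : V) iV = 1.
Proof. by rewrite sumR_const; apply: Rinv_r; exact: Rgt_not_eq. Qed.

(* The uniform law on functions from [S] to [V]. *)
Definition hashw (f : {ffun S -> V}) : R := \prod_(x : S) / INR #|V|.

Lemma hashw_gt0 f : 0 < hashw f.
Proof.
by apply: big_ind => // [|x y|x _]; [lra | exact: Rmult_lt_0_compat | exact: Rinv_0_lt_compat].
Qed.

(** For distinct u and v the event is split over the common value j. The indicator of f u = f v = j
    is a product over the points of the domain, so the sum over all f factorizes. *)
Lemma hashw_collision (u v : S) :
  \sum_(f : {ffun S -> V}) (hashw f * ind (f u == f v)) = if u == v then 1 else / INR #|V|.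
Proof.
case: (u =P v) => [<-|/eqP uv].
  under eq_bigr do rewrite eqxx Rmult_1_r.
  rewrite /hashw -(bigA_distr_bigA (fun _ _ => / INR #|V|)) big1 // => x _; exact: VK.
have vu : v != u by rewrite eq_sym.
pose e (j : V) (x : S) (i : V) : R := if (x == u) || (x == v) then ind (i == j) else 1.
have eE (f : {ffun S -> V}) j : \prod_(x : S) e j x (f x) = ind (f u == j) * ind (f v == j).
  rewrite (bigD1 u) //= (bigD1 v) //= big1 => [|x /andP[xu xv]].
    by rewrite Rmult_1_r /e !eqxx orbT.
  by rewrite /e (negbTE xu) (negbTE xv).
transitivity (\sum_(f : {ffun S -> V}) \sum_(j : V) \prod_(x : S) (iV * e j x (f x))).
  apply: eq_bigr => f _.
  transitivity (\sum_(j : V) (hashw f * (ind (f u == j) * ind (f v == j)))).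
    rewrite -mulR_sumr; congr (_ * _).
    rewrite (bigD1 (f u)) //= eqxx big1 => [|j /negbTE ju]; last by rewrite eq_sym ju; exact: Rmult_0_l.
    by rewrite Rmult_1_l Rplus_0_r eq_sym.
  by apply: eq_bigr => j _; rewrite big_split -eE.
rewrite exchange_sumR -/iV -[RHS]Rmult_1_r -VK mulR_sumr; apply: eq_bigr => j _.
rewrite -(bigA_distr_bigA (fun x i => iV * e j x i)).
have eS x : (x == u) || (x == v) -> \sum_(i : V) (iV * e j x i) = iV.
  move=> xuv; rewrite /e xuv (bigD1 j) //= eqxx big1 => [|i /negbTE ->]; last exact: Rmult_0_r.
  by rewrite /= Rmult_1_r Rplus_0_r.
rewrite (bigD1 u) //= (bigD1 v) //= [X in _ * (_ * X)]big1 => [|x /andP[xu xv]].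
  by rewrite !eS ?eqxx ?orbT // Rmult_1_r.
apply: etrans VK; apply: eq_bigr => i _.
by rewrite /e (negbTE xu) (negbTE xv) Rmult_1_r.
Qed.

End RandomHash.

Section Averaging.
Variables (C : finType) (W : C -> R).
Hypotheses (W0 : forall c, 0 < W c) (W1 : \sum_c W c = 1).

Lemma jensen_ln (Y : C -> R) : (forall c, 0 < Y c) ->
  \sum_c (W c * ln (Y c)) <= ln (\sum_c (W c * Y c)).
Proof.
move=> Y0; set m := \sum_c (W c * Y c).
have [c0 _|no] := pickP (@predT C); last first.
  by move: W1; rewrite big_pred0 // => ?; lra.
have m0 : 0 < m.
  apply: (Rlt_le_trans _ (W c0 * Y c0)); first exact: Rmult_lt_0_compat.
  apply: (@sumR_term _ predT (fun c => W c * Y c)) => // c.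
  by left; exact: Rmult_lt_0_compat.
have rho1 : \sum_c (W c * (Y c / m)) <= 1.
  have -> : \sum_c (W c * (Y c / m)) = m * / m.
    by rewrite /m mulR_suml; apply: eq_bigr => c _; rewrite /Rdiv Rmult_assoc.
  by rewrite Rinv_r; lra.
have := gibbs (fun c => Rlt_le _ _ (W0 c)) W1 (fun c _ => Rdiv_lt_0_compat _ _ (Y0 c) m0) rho1.
have -> : \sum_c (W c * ln (Y c / m)) = \sum_c (W c * ln (Y c) - W c * ln m).
  by apply: eq_bigr => c _; rewrite ln_div //; ring.
by rewrite sumRB -mulR_suml W1; lra.
Qed.

Lemma exists_le_average (Phi : C -> R) (b : R) :
  \sum_c (W c * Phi c) <= b -> exists c, Phi c <= b.
Proof.
move=> le; have [c hc|no] := pickP (fun c => Rle_dec (Phi c) b).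
  by exists c; move: hc; case: Rle_dec.
have gt c : b < Phi c by move: (no c); case: Rle_dec => //= /Rnot_le_lt.
have [c0 _|no'] := pickP (@predT C); last first.
  by move: W1; rewrite big_pred0 // => ?; lra.
have t0 c : 0 <= W c * (Phi c - b).
  by apply: Rmult_le_pos; [left | have := gt c; lra].
have h1 : W c0 * (Phi c0 - b) <= \sum_c (W c * (Phi c - b)).
  exact: (@sumR_term _ predT (fun c => W c * (Phi c - b))).
have h2 : 0 < W c0 * (Phi c0 - b) by apply: Rmult_lt_0_compat => //; have := gt c0; lra.
have h3 : \sum_c (W c * (Phi c - b)) = \sum_c (W c * Phi c) - b.
  transitivity (\sum_c (W c * Phi c - W c * b)); first by apply: eq_bigr => c _; ring.
  by rewrite sumRB -mulR_suml W1; lra.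
lra.
Qed.

End Averaging.

(** * Decoding from side information and a public message *)

Section Decoder.
Variables (Om : finType) (w : Om -> R).
Hypotheses (w0 : forall x, 0 <= w x) (w1 : \sum_x w x = 1).
Variables (TV Tt TU : eqType) (V : Om -> TV) (t : Om -> Tt) (U : Om -> TU).

(** The joint probability of the values of V and U at x. For a fixed value of V it orders the
    candidate values of U as their posterior probabilities do. *)
Definition score (x : Om) : R := cls w (fun x => (V x, U x)) x.

Definition confusable (x y : Om) : bool :=
  [&& V y == V x, t y == t x & U y != U x].

(* The event outside of which the maximum-likelihood decoder, which sees [V] and
   [t], recovers [U]. *)
Definition ambiguous (x : Om) : bool :=
  [exists y, confusable x y && Rle_dec (score x) (score y)].

Lemma decoder (N : eqType) (K : Om -> N) (k0 : N) : refines U K ->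
  exists D, refines (fun x => (V x, t x)) D /\
    Prob w (fun x => D x != K x) <= Prob w ambiguous.
Proof.
move=> UK.
(* [best x] holds of the consistent candidates that strictly beat every rival with another value of
   U, and depends on x only through V x and t x. The default [k0] is met only at ambiguous points,
   since x itself qualifies at the others. *)
pose best (x : Om) := fun y : Om => [&& V y == V x, t y == t x &
  [forall z, [&& V z == V x, t z == t x & U z != U y] ==> Rlt_dec (score z) (score y)]].
exists (fun x => if [pick y | best x y] is Some y then K y else k0); split.
  by move=> x y [eV et]; rewrite /best eV et.
apply: sumR_le_pred => // x; apply: contraR => /existsPn amb.
have amb' z : confusable x z -> score z < score x.
  by move=> cz; move: (amb z); rewrite cz; case: Rle_dec => //= /Rnot_le_lt.
case: pickP => [y /and3P[/eqP Vy /eqP ty /forallP hy]|/(_ x)]; last first.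
  rewrite /best !eqxx /= => /negP[]; apply/forallP => z; apply/implyP => cz.
  by case: Rlt_dec => // -[]; exact: amb'.
apply/eqP/UK/eqP; apply: contraT => Uyx.
have := amb' y; rewrite /confusable Vy ty !eqxx => /(_ Uyx).
have := hy x; rewrite !eqxx eq_sym Uyx /=; case: Rlt_dec => //= *; lra.
Qed.

Definition confusion (x : Om) : R :=
  \sum_y (w y / score x * ind (confusable x y)).

(** An ambiguous x has a rival y with score at least that of x. As t is a function of U, the whole
    (V, U)-class of y is confusable with x, so [confusion x] is at least 1, and 1 <= 2 * ln 2. The
    logarithm stands in for the truncated union bound min (1, u) and keeps concavity for Jensen. *)
Lemma ambiguous_le x : refines U t -> 0 < w x -> ind (ambiguous x) <= 2 * ln (1 + confusion x).
Proof.
move=> Ut wx; have s0 : 0 < score x by exact: cls_gt0.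
have is0 := Rinv_0_lt_compat _ s0.
have t0 y : 0 <= w y / score x * ind (confusable x y).
  apply: Rmult_le_pos; last exact: ind_ge0.
  by apply: Rmult_le_pos => //; lra.
have Y0 : 0 <= confusion x by apply: sumR_ge0 => y _.
case amb: (ambiguous x) => /=; last first.
  by rewrite /ind; have := @ln_le_mono 1 (1 + confusion x); rewrite ln_1; lra.
move/existsP: amb => [y /andP[/and3P[/eqP Vy /eqP ty Uy]]].
case: Rle_dec => // sxy _.
suff Y1 : 1 <= confusion x.
  by have := ln_lt_2; have := @ln_le_mono 2 (1 + confusion x); rewrite /ind; lra.
apply: (Rle_trans _ (score y / score x)).
  rewrite -(Rinv_r (score x)); last lra.
  by apply: Rmult_le_compat_r => //; lra.
rewrite {1}/score /cls /Rdiv mulR_suml (sumR_ind (fun z => (V y, U y) == (V z, U z))).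
apply: sumR_le => z _; case: eqP => [[eV eU]|_] /=; last by rewrite Rmult_0_l; exact: t0.
by rewrite /confusable -eV -eU -(Ut _ _ eU) Vy ty Uy !eqxx /= Rmult_1_l Rmult_1_r; exact: Rle_refl.
Qed.

End Decoder.

(** * The random code: mean decoding error and mean leakage *)

Section RandomCode.
Variables (Om : finType) (w : Om -> R).
Hypotheses (w0 : forall x, 0 <= w x) (w1 : \sum_x w x = 1).
Variables (TA TB TF TG TH : finType) (A : Om -> TA) (B : Om -> TB).
Hypotheses (F0 : 0 < INR #|TF|) (G0 : 0 < INR #|TG|) (H0 : 0 < INR #|TH|).

Definition code : finType := ({ffun TA -> TF} * {ffun TB -> TG} * {ffun TA * TB -> TH})%type.
Implicit Types (c : code) (x y : Om).

Definition codew c : R := hashw c.1.1 * hashw c.1.2 * hashw c.2.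
Definition source x := (A x, B x).
Definition public c x := (c.1.1 (A x), c.1.2 (B x)).
Definition key c x := c.2 (source x).

Local Notation mF := (INR #|TF|).
Local Notation mG := (INR #|TG|).
Local Notation mH := (INR #|TH|).

Lemma codew_gt0 c : 0 < codew c.
Proof. by do 2 (apply: Rmult_lt_0_compat; last exact: hashw_gt0); exact: hashw_gt0. Qed.

Lemma codew_prod (phi : {ffun TA -> TF} -> R) (gam : {ffun TB -> TG} -> R)
    (eta : {ffun TA * TB -> TH} -> R) :
  \sum_c (codew c * (phi c.1.1 * gam c.1.2 * eta c.2)) =
  (\sum_f (hashw f * phi f)) * (\sum_g (hashw g * gam g)) * (\sum_h (hashw h * eta h)).
Proof.
rewrite mulR_suml.
rewrite (sumR_pair (fun p h => hashw p.1 * hashw p.2 * hashw h * (phi p.1 * gam p.2 * eta h))).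
rewrite (sumR_pair (fun f g => \sum_h (hashw f * hashw g * hashw h * (phi f * gam g * eta h)))).
rewrite mulR_suml; apply: eq_bigr => f _.
rewrite [X in X * _]mulR_sumr mulR_suml; apply: eq_bigr => g _.
by rewrite mulR_sumr; apply: eq_bigr => h _; ring.
Qed.

Definition coll (T : finType) (b : bool) : R := if b then 1 else / INR #|T|.

Lemma mean_collision (a a' : TA) (b b' : TB) (s s' : TA * TB) :
  \sum_c (codew c * (ind (c.1.1 a == c.1.1 a') * ind (c.1.2 b == c.1.2 b') *
                     ind (c.2 s == c.2 s'))) =
  coll TF (a == a') * coll TG (b == b') * coll TH (s == s').
Proof.
rewrite (codew_prod (fun f => ind (f a == f a')) (fun g => ind (g b == g b'))
  (fun h => ind (h s == h s'))).
by rewrite !hashw_collision.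
Qed.

(** A point collides with itself with probability 1, and a point exists because [w] has total mass
    1. *)
Lemma codew_sum1 : \sum_c codew c = 1.
Proof.
have [x _|no] := pickP (@predT Om); last by move: w1; rewrite big_pred0 // => ?; lra.
have := mean_collision (A x) (A x) (B x) (B x) (source x) (source x).
rewrite !eqxx /= !Rmult_1_r => <-.
by apply: eq_bigr => c _; rewrite !eqxx /ind !Rmult_1_r.
Qed.

Section View.
Variables (TV : eqType) (V : Om -> TV).

(** One term for each way in which a wrong pair can differ from the true one: in A only, in B only,
    or in both. The hash of each differing component must collide. *)
Definition confusion_bound x : R :=
  (cls w (fun y => (V y, B y)) x * / mF + cls w (fun y => (V y, A y)) x * / mG +
   cls w V x * (/ mF * / mG)) / score w V source x.

Lemma mean_confusable x y :
  \sum_c (codew c * ind (confusable V (public c) source x y)) <=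
  ind ((V x, B x) == (V y, B y)) * / mF + ind ((V x, A x) == (V y, A y)) * / mG
  + ind (V x == V y) * (/ mF * / mG).
Proof.
have f0 := Rinv_0_lt_compat _ F0; have g0 := Rinv_0_lt_compat _ G0.
have fg0 := Rmult_lt_0_compat _ _ f0 g0.
have i1 := ind_ge0 ((V x, B x) == (V y, B y)); have i2 := ind_ge0 ((V x, A x) == (V y, A y)).
have i3 := ind_ge0 (V x == V y).
have p1 := Rmult_le_pos _ _ i1 (Rlt_le _ _ f0); have p2 := Rmult_le_pos _ _ i2 (Rlt_le _ _ g0).
have p3 := Rmult_le_pos _ _ i3 (Rlt_le _ _ fg0).
rewrite /confusable [V y == _]eq_sym.
have [eAB|nAB] := boolP (source y == source x).
  by rewrite big1 => [|c _]; [lra | rewrite !andbF; exact: Rmult_0_r].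
have [eV|nV] := boolP (V x == V y); last first.
  by rewrite big1 => [|c _]; [rewrite (negbTE nV) in p3; lra | exact: Rmult_0_r].
rewrite !xpair_eqE (eqP eV) eqxx /=.
(* The key hash is fed two equal arguments, a factor 1 that gives the summand the form of
   [mean_collision]. *)
rewrite (eq_bigr (fun c => codew c * (ind (c.1.1 (A x) == c.1.1 (A y)) *
    ind (c.1.2 (B x) == c.1.2 (B y)) * ind (c.2 (source x) == c.2 (source x))))); last first.
  move=> c _; rewrite !xpair_eqE andbT eqxx Rmult_1_r.
  rewrite [c.1.1 (A y) == _]eq_sym [c.1.2 (B y) == _]eq_sym.
  by case: (_ == _) (_ == _) => [] []; rewrite /ind /=; ring.
rewrite mean_collision eqxx; move: nAB; rewrite /source xpair_eqE [A y == _]eq_sym [B y == _]eq_sym.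
rewrite /coll; move: f0 g0 fg0; clear; move: (/ INR _) (/ INR _) => u v.
by case: (A x == A y) (B x == B y) => [] []; rewrite //= /ind => *; lra.
Qed.

Lemma mean_confusion x : 0 < w x ->
  \sum_c (codew c * confusion w V (public c) source x) <= confusion_bound x.
Proof.
move=> wx; set s := score w V source x.
have is0 : 0 < / s by apply: Rinv_0_lt_compat; exact: cls_gt0.
have -> : \sum_c (codew c * confusion w V (public c) source x) =
    \sum_y (w y / s * \sum_c (codew c * ind (confusable V (public c) source x y))).
  rewrite /confusion -/s; under eq_bigr do rewrite mulR_sumr.
  rewrite exchange_sumR; apply: eq_bigr => y _; rewrite mulR_sumr.
  by apply: eq_bigr => c _; ring.
apply: (Rle_trans _ (\sum_y (w y / s * (ind ((V x, B x) == (V y, B y)) * / mF +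
   ind ((V x, A x) == (V y, A y)) * / mG + ind (V x == V y) * (/ mF * / mG))))).
  apply: sumR_le => y _; apply: Rmult_le_compat_l; last exact: mean_confusable.
  by apply: Rmult_le_pos => //; lra.
rewrite /confusion_bound -/s /cls (sumR_ind (fun y => (V x, B x) == (V y, B y))).
rewrite (sumR_ind (fun y => (V x, A x) == (V y, A y))) (sumR_ind (fun y => V x == V y)).
rewrite /Rdiv !mulR_suml -!sumRD mulR_suml; right; apply: eq_bigr => y _; ring.
Qed.

Lemma mean_ambiguous :
  \sum_c (codew c * Prob w (ambiguous w V (public c) source)) <=
  2 * \sum_x (w x * ln (1 + confusion_bound x)).
Proof.
have -> : \sum_c (codew c * Prob w (ambiguous w V (public c) source)) =
    \sum_x (w x * \sum_c (codew c * ind (ambiguous w V (public c) source x))).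
  transitivity (\sum_c \sum_x (codew c * (ind (ambiguous w V (public c) source x) * w x))).
    by apply: eq_bigr => c _; rewrite /Prob /finRsum (sumR_ind (ambiguous w V (public c) source)) mulR_sumr.
  rewrite exchange_sumR; apply: eq_bigr => x _; rewrite mulR_sumr.
  by apply: eq_bigr => c _; ring.
rewrite mulR_sumr; apply: sumR_le => x _.
have [->|wx] := w_split w0 x; first lra.
rewrite -Rmult_assoc [2 * _]Rmult_comm Rmult_assoc; apply: Rmult_le_compat_l => //.
have conf0 c : 0 <= confusion w V (public c) source x.
  apply: sumR_ge0 => y _; apply: Rmult_le_pos; last exact: ind_ge0.
  by apply: Rmult_le_pos => //; left; apply: Rinv_0_lt_compat; exact: cls_gt0.
apply: (Rle_trans _ (\sum_c (codew c * (2 * ln (1 + confusion w V (public c) source x))))).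
  apply: sumR_le => c _; apply: Rmult_le_compat_l; first by left; exact: codew_gt0.
  apply: ambiguous_le => // y z [e1 e2]; by rewrite /public e1 e2.
have -> : \sum_c (codew c * (2 * ln (1 + confusion w V (public c) source x))) =
    2 * \sum_c (codew c * ln (1 + confusion w V (public c) source x)).
  by rewrite mulR_sumr; apply: eq_bigr => c _; ring.
apply: Rmult_le_compat_l; first lra.
apply: Rle_trans (jensen_ln codew_gt0 codew_sum1 _) _; first by move=> c; have := conf0 c; lra.
have -> : \sum_c (codew c * (1 + confusion w V (public c) source x)) =
    1 + \sum_c (codew c * confusion w V (public c) source x).
  by rewrite -[X in _ = X + _]codew_sum1 -sumRD; apply: eq_bigr => c _; ring.
apply: ln_le_mono; last by have := mean_confusion wx; lra.
have : 0 <= \sum_c (codew c * confusion w V (public c) source x).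
  by apply: sumR_ge0 => c _; apply: Rmult_le_pos; [left; exact: codew_gt0 | ].
lra.
Qed.

End View.

(* How far the joint law of hashes and key is from uniform; it bounds both the
   information leaked on the key and the loss in its entropy. *)
Definition leak c : R := ln (mF * mG * mH) - Ent w (fun x => (public c x, key c x)).

(** The number of values of (public, key) times a bound on the probability that an independent
    source point collides with x, less the 1 of a uniform law. The terms come from points agreeing
    with x in both components, in A, and in B. *)
Definition leak_bound x : R :=
  mF * mG * mH * cls w source x + mF * cls w A x + mG * cls w B x.

Lemma mean_public_key x y :
  \sum_c (codew c * ind ((public c x, key c x) == (public c y, key c y))) <=
  ind (source x == source y) + ind (A x == A y) * (/ mG * / mH)
  + ind (B x == B y) * (/ mF * / mH) + / mF * / mG * / mH.
Proof.
have f0 := Rinv_0_lt_compat _ F0; have g0 := Rinv_0_lt_compat _ G0.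
have h0 := Rinv_0_lt_compat _ H0.
rewrite (eq_bigr (fun c => codew c * (ind (c.1.1 (A x) == c.1.1 (A y)) *
    ind (c.1.2 (B x) == c.1.2 (B y)) * ind (c.2 (source x) == c.2 (source y))))); last first.
  move=> c _; rewrite !xpair_eqE /key.
  by case: (_ == _) (_ == _) (_ == _) => [] [] []; rewrite /ind /=; ring.
rewrite mean_collision /source xpair_eqE /coll.
move: f0 g0 h0; clear; move: (/ INR _) (/ INR _) (/ INR _) => u v t u0 v0 t0.
have uv := Rmult_lt_0_compat _ _ u0 v0; have ut := Rmult_lt_0_compat _ _ u0 t0.
have vt := Rmult_lt_0_compat _ _ v0 t0; have uvt := Rmult_lt_0_compat _ _ uv t0.
by case: (A x == A y) (B x == B y) => [] []; rewrite //= /ind; lra.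
Qed.

(** [leak c] is the mean over x of ln (n * Pr[public, key]), with n the number of values. Jensen
    moves the code average inside, where collision probabilities give at most 1 + [leak_bound x]. *)
Lemma mean_leak : \sum_c (codew c * leak c) <= \sum_x (w x * ln (1 + leak_bound x)).
Proof.
pose n := mF * mG * mH; pose pk c x := (public c x, key c x).
have n0 : 0 < n by do 2 (apply: Rmult_lt_0_compat => //).
have -> : \sum_c (codew c * leak c) = \sum_x (w x * \sum_c (codew c * ln n +
    codew c * ln (cls w (pk c) x))).
  transitivity (\sum_c \sum_x (codew c * (w x * ln n) + codew c * (w x * ln (cls w (pk c) x)))).
    apply: eq_bigr => c _; rewrite sumRD -!mulR_sumr -mulR_suml w1 /leak EntE -/n -/(pk c); ring.
  rewrite exchange_sumR; apply: eq_bigr => x _; rewrite mulR_sumr.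
  by apply: eq_bigr => c _; ring.
apply: sumR_le => x _; have [->|wx] := w_split w0 x; first lra.
apply: Rmult_le_compat_l => //.
have c0 c : 0 < cls w (pk c) x by exact: cls_gt0.
have -> : \sum_c (codew c * ln n + codew c * ln (cls w (pk c) x)) =
    \sum_c (codew c * ln (n * cls w (pk c) x)).
  by apply: eq_bigr => c _; rewrite ln_mult //; ring.
apply: Rle_trans (jensen_ln codew_gt0 codew_sum1 _) _; first by move=> c; exact: Rmult_lt_0_compat.
have W0 c : 0 < codew c * (n * cls w (pk c) x).
  by apply: Rmult_lt_0_compat; [exact: codew_gt0 | exact: Rmult_lt_0_compat].
apply: ln_le_mono.
  have [c _|no] := pickP (@predT code); last by move: codew_sum1; rewrite big_pred0 // => ?; lra.
  apply: Rlt_le_trans (W0 c) _; apply: (@sumR_term _ predT (fun c => codew c * (n * cls w (pk c) x))) => // d.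
  by left.
have -> : \sum_c (codew c * (n * cls w (pk c) x)) =
    \sum_y (w y * (n * \sum_c (codew c * ind (pk c x == pk c y)))).
  transitivity (\sum_c \sum_y (codew c * (n * (ind (pk c x == pk c y) * w y)))).
    by apply: eq_bigr => c _; rewrite {1}/cls (sumR_ind (fun y => pk c x == pk c y)) !mulR_sumr.
  rewrite exchange_sumR; apply: eq_bigr => y _; rewrite !mulR_sumr.
  by apply: eq_bigr => c _; ring.
apply: (Rle_trans _ (\sum_y (w y + (n * (ind (source x == source y) * w y) +
   mF * (ind (A x == A y) * w y) + mG * (ind (B x == B y) * w y))))).
  apply: sumR_le => y _.
  have := Rmult_le_compat_l _ _ _ (Rlt_le _ _ n0) (mean_public_key x y).
  have -> : n * (ind (source x == source y) + ind (A x == A y) * (/ mG * / mH)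
      + ind (B x == B y) * (/ mF * / mH) + / mF * / mG * / mH) =
    n * ind (source x == source y) + mF * ind (A x == A y) + mG * ind (B x == B y) + 1.
    by rewrite /n; field; lra.
  move/(Rmult_le_compat_l _ _ _ (w0 y)) => le; apply: Rle_trans le _; right; ring.
right; rewrite !sumRD w1 -!mulR_sumr /leak_bound -/n /cls.
by rewrite (sumR_ind (fun y => source x == source y)) (sumR_ind (fun y => A x == A y))
  (sumR_ind (fun y => B x == B y)).
Qed.

Lemma Ent_public_le c : Ent w (public c) <= ln (mF * mG).
Proof. by have := Ent_le_ln_card w0 w1 (public c); rewrite card_prod mult_INR. Qed.

Lemma leak_ge0 c : 0 <= leak c.
Proof.
have le : Ent w (fun x => (public c x, key c x)) <= ln (mF * mG * mH).
  have := Ent_le_ln_card w0 w1 (fun x => (public c x, key c x)).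
  by rewrite !card_prod !mult_INR.
by rewrite /leak; lra.
Qed.

Lemma MI_key_public_le c : MI w (key c) (public c) <= leak c.
Proof.
have le1 := Ent_public_le c.
have le2 : Ent w (key c) <= ln mH by exact: Ent_le_ln_card.
have eq : Ent w (fun x => (key c x, public c x)) = Ent w (fun x => (public c x, key c x)).
  by apply: Ent_kernel => x y /(congr1 (fun p => (p.2, p.1))).
rewrite /leak /MI eq (ln_mult (mF * mG)) //; first lra.
exact: Rmult_lt_0_compat.
Qed.

Lemma Ent_key_ge c : ln mH - leak c <= Ent w (key c).
Proof.
have le1 := Ent_public_le c.
have le2 : Ent w (fun x => (public c x, key c x)) <= Ent w (public c) + Ent w (key c).
  exact: Ent_pair_le.
rewrite /leak (ln_mult (mF * mG)) //; first lra.
exact: Rmult_lt_0_compat.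
Qed.

(** All decoders and the secrecy condition must share one code, so their costs are added before
    averaging. The costs being nonnegative, a bound on the sum bounds each. *)
Lemma exists_code (I : finType) (TV : I -> eqType) (V : forall i, Om -> TV i) :
  exists c, \sum_i Prob w (ambiguous w (V i) (public c) source) + leak c <=
    \sum_i (2 * \sum_x (w x * ln (1 + confusion_bound (V i) x)))
    + \sum_x (w x * ln (1 + leak_bound x)).
Proof.
apply: (exists_le_average codew_gt0 codew_sum1).
have -> : \sum_c (codew c * (\sum_i Prob w (ambiguous w (V i) (public c) source) + leak c)) =
    \sum_i \sum_c (codew c * Prob w (ambiguous w (V i) (public c) source)) +
    \sum_c (codew c * leak c).
  rewrite exchange_sumR -sumRD; apply: eq_bigr => c _.
  by rewrite Rmult_plus_distr_l mulR_sumr.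
apply: Rplus_le_compat; last exact: mean_leak.
by apply: sumR_le => i _; exact: mean_ambiguous.
Qed.

End RandomCode.

Definition exp_ceil (y : R) : nat := Z.to_nat (up (exp y)).

(** [up] overshoots by at most 1, which is at most exp y. *)
Lemma exp_ceil_bounds y : 0 <= y -> exp y <= INR (exp_ceil y) <= 2 * exp y.
Proof.
move=> y0; have [u1 u2] := archimed (exp y); have e0 := exp_pos y.
have e1 := exp_ineq1_le y.
have z0 : (0 <= up (exp y))%Z by apply: le_IZR; lra.
by rewrite /exp_ceil INR_IZR_INZ Z2Nat.id //; lra.
Qed.

(** Expand (1 + u) (1 + v) (1 + t). This lets the three terms of each error bound vanish
    separately. *)
Lemma ln1D3_le u v t : 0 <= u -> 0 <= v -> 0 <= t ->
  ln (1 + (u + v + t)) <= ln (1 + u) + ln (1 + v) + ln (1 + t).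
Proof.
move=> u0 v0 t0.
have uv := Rmult_le_pos _ _ u0 v0; have ut := Rmult_le_pos _ _ u0 t0.
have vt := Rmult_le_pos _ _ v0 t0; have uvt := Rmult_le_pos _ _ uv t0.
by rewrite -!ln_mult; [apply: ln_le_mono | | | |]; nra.
Qed.

(** * From a code to a protocol of one block length *)

Section CodedProtocol.
Variables (X : 'I_3 -> finType) (P : Sample X -> R).
Hypotheses (P0 : forall x, 0 <= P x) (P1 : \sum_x P x = 1).
Variables (a b : 'I_3) (n : nat) (mF mG mH : nat).
Hypotheses (F0 : 0 < INR mF) (G0 : 0 < INR mG) (H0 : 0 < INR mH).

Definition protocol_error : R :=
  \sum_(i : 'I_3) (2 * \sum_x (@Pn X P n x *
     ln (1 + confusion_bound (@Pn X P n) 'I_mF 'I_mG (@obs X a n) (@obs X b n) (@obs X i n) x)))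
  + \sum_x (@Pn X P n x * ln (1 + leak_bound (@Pn X P n) 'I_mF 'I_mG 'I_mH (@obs X a n) (@obs X b n) x)).

Definition good_scheme (pK : protocol X n * (SampleN X n -> nat)) (d l : R) : Prop :=
  [/\ valid_protocol pK.1, only_from [set a; b] pK.1,
    exists Ji : 'I_3 -> SampleN X n -> nat,
      (forall i x y, agree_i i x y -> transcript pK.1 x = transcript pK.1 y -> Ji i x = Ji i y) /\
      Prob (@Pn X P n) (fun x => [forall i, Ji i x == pK.2 x]) >= 1 - d,
    MI (@Pn X P n) pK.2 (transcript pK.1) <= d
  & l - d <= Ent (@Pn X P n) pK.2].

Lemma exists_good_scheme : exists pK, good_scheme pK protocol_error (ln (INR mH)).
Proof.
have w0 := @Pn_ge0 X P P0 n; have w1 := @Pn_sum1 X P P1 n.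
have cF : 0 < INR #|'I_mF| by rewrite card_ord.
have cG : 0 < INR #|'I_mG| by rewrite card_ord.
have cH : 0 < INR #|'I_mH| by rewrite card_ord.
have [c hc] := exists_code w0 w1 (@obs X a n) (@obs X b n) cF cG cH (fun i => @obs X i n).
rewrite -/protocol_error in hc.
pose A := @obs X a n; pose B := @obs X b n.
pose p : protocol X n := [:: (a, fun _ x => nat_of_ord (c.1.1 (A x)));
                             (b, fun _ x => nat_of_ord (c.1.2 (B x)))].
pose K x : nat := key A B c x.
(* Ordinals embed injectively into the naturals, so the transcript and [K] have the kernels of
   [public] and [key], hence the same entropies. *)
have pub x y : transcript p x = transcript p y <-> public A B c x = public A B c y.
  by split=> [[/val_inj e1 /val_inj e2]|[e1 e2]]; rewrite /transcript /public /= ?e1 ?e2.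
have keyE x y : K x = K y <-> key A B c x = key A B c y.
  by split=> [/ord_inj|]; rewrite /K // => ->.
have EntK : Ent (@Pn X P n) K = Ent (@Pn X P n) (key A B c).
  by apply: Ent_kernel => x y /keyE.
have amb0 i : 0 <= Prob (@Pn X P n) (ambiguous (@Pn X P n) (@obs X i n) (public A B c) (source A B)).
  by apply: sumR_ge0.
pose S := \sum_i Prob (@Pn X P n) (ambiguous (@Pn X P n) (@obs X i n) (public A B c) (source A B)).
have S0 : 0 <= S by apply: sumR_ge0.
have {}hc : S + leak (@Pn X P n) A B c <= protocol_error := hc.
have L0 := leak_ge0 w0 w1 A B c.
have UK : refines (source A B) K by move=> x y e; rewrite /K /key e.
have [D hD] := fin_all_exists (fun i => decoder w0 (@obs X i n) (public A B c) 0%N UK).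
exists (p, K); split=> /=.
- do ![apply: List.Forall_cons => [prev x y|]]; rewrite ?agree_obs /=; last exact: List.Forall_nil.
  + by move/eqP => e; rewrite /A e.
  + by move/eqP => e; rewrite /B e.
- by do ![apply: List.Forall_cons => [|]]; rewrite ?set21 ?set22 //; exact: List.Forall_nil.
- exists D; split.
    by move=> i x y; rewrite agree_obs => /eqP e1 /pub e2; apply: (hD i).1; rewrite e1 e2.
  pose q := Prob (@Pn X P n) (fun x => [forall i, D i x == K x]).
  have e1 : q + Prob (@Pn X P n) (fun x => ~~ [forall i, D i x == K x]) = 1 := Prob_setC w1 _.
  have e2 : Prob (@Pn X P n) (fun x => ~~ [forall i, D i x == K x]) <=
    \sum_i Prob (@Pn X P n) (fun x => D i x != K x).
    rewrite /Prob /finRsum.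
    rewrite (sumR_ind (fun x => ~~ [forall i, D i x == K x])).
    under [X in _ <= X]eq_bigr => i _ do rewrite (sumR_ind (fun x => D i x != K x)).
    rewrite exchange_sumR; apply: sumR_le => x _.
    have t0 i : 0 <= ind (D i x != K x) * Pn P x by apply: Rmult_le_pos => //; exact: ind_ge0.
    case: forallPn => [[i Di]|_]; last by rewrite Rmult_0_l; apply: sumR_ge0.
    apply: Rle_trans (@sumR_term _ predT (fun i => ind (D i x != K x) * Pn P x) i t0 isT).
    by rewrite Di; exact: Rle_refl.
  have e3 : \sum_i Prob (@Pn X P n) (fun x => D i x != K x) <= S.
    by apply: sumR_le => i _; exact: (hD i).2.
  by rewrite -/q; lra.
- have eqK := EntK.
  have eqT : Ent (@Pn X P n) (transcript p) = Ent (@Pn X P n) (public A B c).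
    by apply: Ent_kernel => x y /pub.
  have eqKT : Ent (@Pn X P n) (fun x => (K x, transcript p x)) =
              Ent (@Pn X P n) (fun x => (key A B c x, public A B c x)).
    apply: Ent_kernel => x y e.
      have /keyE e1 : K x = K y := congr1 fst e; have /pub e2 := congr1 snd e.
      by rewrite e1 e2.
    have /keyE e1 : key A B c x = key A B c y := congr1 fst e.
    have /pub e2 : public A B c x = public A B c y := congr1 snd e.
    by rewrite e1 e2.
  have eqMI : MI (@Pn X P n) K (transcript p) = MI (@Pn X P n) (key A B c) (public A B c).
    by rewrite /MI eqK eqT eqKT.
  by rewrite eqMI; apply: Rle_trans (MI_key_public_le w0 w1 A B cF cG cH c) _; lra.
- rewrite EntK; apply: Rle_trans (Ent_key_ge w0 w1 A B cF cG cH c).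
  by rewrite card_ord; lra.
Qed.

End CodedProtocol.

(** * Achievability: admissible hash and key rates *)

Lemma Rinv_le_exp m y : exp y <= m -> 0 < / m <= exp (- y).
Proof.
move=> le; have e0 := exp_pos y; rewrite exp_Ropp; split.
  by apply: Rinv_0_lt_compat; lra.
by apply: Rinv_le_contravar.
Qed.

Section Achievability.
Variables (X : 'I_3 -> finType) (P : Sample X -> R).
Hypotheses (P0 : forall x, 0 <= P x) (P1 : \sum_x P x = 1).
Variables (a b : 'I_3).

Local Notation Pw n := (@Pn X P n).
Definition coord2 (i j : 'I_3) (t : Sample X) := (coord i t, coord j t).
Definition view (i : 'I_3) (t : Sample X) := (coord i t, coord2 a b t).
Local Notation cAB := (coord2 a b).
Local Notation hab := (Ent P cAB).

Lemma Pn_ln_vanish (V1 V2 : eqType) (f1 : Sample X -> V1) (f2 : Sample X -> V2) (C r delta : R) :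
  1 <= C -> r - Ent P f1 + Ent P f2 < 0 -> 0 < delta ->
  exists N, forall n, (N <= n)%N ->
    \sum_x (Pw n x * ln (1 + C * exp (INR n * r) * cls (Pw n) (pointwise f1) x
                                    / cls (Pw n) (pointwise f2) x)) <= delta.
Proof. exact: iid_ln_vanish. Qed.

Lemma cls_obs_pair n i j (x : SampleN X n) :
  cls (Pw n) (fun y => (obs i y, obs j y)) x =
  cls (Pw n) (pointwise (coord2 i j)) x.
Proof. by apply: cls_kernel => y z /pointwise_pair. Qed.

Lemma score_obs n i (x : SampleN X n) :
  score (Pw n) (@obs X i n) (source (@obs X a n) (@obs X b n)) x =
  cls (Pw n) (pointwise (view i)) x.
Proof.
apply: cls_kernel => y z.
  by case=> e1 e2 e3; apply/pointwise_pair; congr (_, _) => //; apply/pointwise_pair; congr (_, _).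
by move/pointwise_pair => [e1 /pointwise_pair [e2 e3]]; rewrite /source /obs e1 e2 e3.
Qed.

(** The Slepian-Wolf conditions for a decoder with side information X_i: ra > H(Xa|Xb,Xi), rb >
    H(Xb|Xa,Xi) and ra + rb > H(Xa,Xb|Xi), one for each kind of wrong pair. *)
Lemma confusion_vanish i (ra rb delta : R) :
  Ent P (view i) - Ent P (coord2 i b) < ra ->
  Ent P (view i) - Ent P (coord2 i a) < rb ->
  Ent P (view i) - Ent P (coord i) < ra + rb ->
  0 < delta ->
  exists N, forall n mF mG, (N <= n)%N -> exp (INR n * ra) <= INR mF -> exp (INR n * rb) <= INR mG ->
    \sum_x (Pw n x * ln (1 + confusion_bound (Pw n) 'I_mF 'I_mG
       (@obs X a n) (@obs X b n) (@obs X i n) x)) <= delta.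
Proof.
move=> ca cb cab d0; have d3 : 0 < delta / 3 by lra.
pose s := view i.
have c1 : - ra - Ent P (coord2 i b) + Ent P s < 0 by rewrite /s; lra.
have c2 : - rb - Ent P (coord2 i a) + Ent P s < 0 by rewrite /s; lra.
have c3 : - (ra + rb) - Ent P (coord i) + Ent P s < 0 by rewrite /s; lra.
have [N1 h1] := Pn_ln_vanish (Rle_refl 1) c1 d3.
have [N2 h2] := Pn_ln_vanish (Rle_refl 1) c2 d3.
have [N3 h3] := Pn_ln_vanish (Rle_refl 1) c3 d3.
exists (N1 + N2 + N3)%N => n mF mG Nn hF hG.
have {}h1 := h1 n (leq_trans (leq_trans (leq_addr N2 _) (leq_addr N3 _)) Nn).
have {}h2 := h2 n (leq_trans (leq_trans (leq_addl N1 _) (leq_addr N3 _)) Nn).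
have {}h3 := h3 n (leq_trans (leq_addl _ _) Nn).
apply: Rle_trans (_ : _ <= delta / 3 + delta / 3 + delta / 3) _; last lra.
apply: Rle_trans (Rplus_le_compat _ _ _ _ (Rplus_le_compat _ _ _ _ h1 h2) h3).
rewrite -!sumRD; apply: sumR_le => x _; rewrite -!Rmult_plus_distr_l.
have [->|wx] := w_split (@Pn_ge0 X P P0 n) x; first lra.
apply: Rmult_le_compat_l; first lra.
have [f0 f1] := Rinv_le_exp hF; have [g0 g1] := Rinv_le_exp hG.
rewrite /confusion_bound score_obs !cls_obs_pair !card_ord -/s.
have pos (V : eqType) (f : Sample X -> V) : 0 < cls (Pw n) (pointwise f) x.
  by apply: cls_gt0 => //; exact: Pn_ge0.
have is0 : 0 < / cls (Pw n) (pointwise s) x by apply: Rinv_0_lt_compat.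
have p1 := pos _ (coord2 i b).
have p2 := pos _ (coord2 i a).
have p3 : 0 < cls (Pw n) (@obs X i n) x := pos _ (coord i).
rewrite -/(@obs X i n) /Rdiv !Rmult_plus_distr_r.
have e3 : exp (INR n * - (ra + rb)) = exp (- (INR n * ra)) * exp (- (INR n * rb)).
  by rewrite -exp_plus; congr exp; ring.
have fg1 : / INR mF * / INR mG <= exp (- (INR n * ra)) * exp (- (INR n * rb)).
  by apply: Rmult_le_compat; lra.
have fg0 := Rmult_lt_0_compat _ _ f0 g0.
have mono c m e : 0 < c -> 0 < m -> m <= e ->
   0 <= c * m * / cls (Pw n) (pointwise s) x /\
   ln (1 + c * m * / cls (Pw n) (pointwise s) x) <=
   ln (1 + 1 * e * c * / cls (Pw n) (pointwise s) x).
  move=> c0 m0 me; have cm := Rmult_lt_0_compat _ _ c0 m0.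
  have q0 := Rmult_lt_0_compat _ _ cm is0; split; first lra.
  apply: ln_le_mono; first lra.
  apply: Rplus_le_compat_l; apply: Rmult_le_compat_r; first lra.
  by rewrite Rmult_1_l Rmult_comm; apply: Rmult_le_compat_r; lra.
have [q1 l1] := mono _ _ _ p1 f0 f1.
have [q2 l2] := mono _ _ _ p2 g0 g1.
have [q3 l3] := mono _ _ _ p3 fg0 fg1.
apply: Rle_trans (ln1D3_le q1 q2 q3) _.
rewrite e3 !Ropp_mult_distr_r_reverse.
exact: Rplus_le_compat (Rplus_le_compat _ _ _ _ l1 l2) l3.
Qed.

(** Under these rate conditions the two public hashes and the key are jointly close to uniform,
    hence the key is nearly independent of the communication. *)
Lemma leak_vanish (ra rb r delta : R) :
  ra < Ent P (coord a) -> rb < Ent P (coord b) -> ra + rb + r < hab -> 0 < delta ->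
  exists N, forall n mF mG mH, (N <= n)%N ->
    0 < INR mF <= 2 * exp (INR n * ra) -> 0 < INR mG <= 2 * exp (INR n * rb) ->
    0 < INR mH <= 2 * exp (INR n * r) ->
    \sum_x (Pw n x * ln (1 + leak_bound (Pw n) 'I_mF 'I_mG 'I_mH
       (@obs X a n) (@obs X b n) x)) <= delta.
Proof.
move=> ca cb cab d0; have d3 : 0 < delta / 3 by lra.
(* A constant has entropy 0 and class probability 1: it fills the denominator in [Pn_ln_vanish]. *)
pose s (t : Sample X) := tt.
have s0 : Ent P s = 0 by exact: Ent_cst.
have c1 : (ra + rb + r) - hab + Ent P s < 0 by rewrite s0; lra.
have c2 : ra - Ent P (coord a) + Ent P s < 0 by rewrite s0; lra.
have c3 : rb - Ent P (coord b) + Ent P s < 0 by rewrite s0; lra.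
(* Each alphabet size is within a factor 2 of an exponential: 8 = 2 * 2 * 2 serves the product of
   the three sizes. *)
have C8 : 1 <= 8 by lra. have C2 : 1 <= 2 by lra.
have [N1 h1] := Pn_ln_vanish C8 c1 d3.
have [N2 h2] := Pn_ln_vanish C2 c2 d3.
have [N3 h3] := Pn_ln_vanish C2 c3 d3.
exists (N1 + N2 + N3)%N => n mF mG mH Nn [F0 F2] [G0 G2] [H0 H2].
have {}h1 := h1 n (leq_trans (leq_trans (leq_addr N2 _) (leq_addr N3 _)) Nn).
have {}h2 := h2 n (leq_trans (leq_trans (leq_addl N1 _) (leq_addr N3 _)) Nn).
have {}h3 := h3 n (leq_trans (leq_addl _ _) Nn).
apply: Rle_trans (_ : _ <= delta / 3 + delta / 3 + delta / 3) _; last lra.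
apply: Rle_trans (Rplus_le_compat _ _ _ _ (Rplus_le_compat _ _ _ _ h1 h2) h3).
rewrite -!sumRD; apply: sumR_le => x _; rewrite -!Rmult_plus_distr_l.
have [->|wx] := w_split (@Pn_ge0 X P P0 n) x; first lra.
apply: Rmult_le_compat_l; first lra.
have s1 : cls (Pw n) (pointwise s) x = 1.
  rewrite -(cls_cst (@Pn_sum1 X P P1 n) tt x); exact: cls_kernel.
have pos (V : eqType) (f : Sample X -> V) : 0 < cls (Pw n) (pointwise f) x.
  by apply: cls_gt0 => //; exact: Pn_ge0.
have p1 := pos _ cAB.
have p2 : 0 < cls (Pw n) (@obs X a n) x := pos _ (coord a).
have p3 : 0 < cls (Pw n) (@obs X b n) x := pos _ (coord b).
rewrite /leak_bound !card_ord cls_obs_pair !s1 !Rdiv_1_r.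
have e3 : 8 * exp (INR n * (ra + rb + r)) =
    2 * exp (INR n * ra) * (2 * exp (INR n * rb)) * (2 * exp (INR n * r)).
  by rewrite !Rmult_plus_distr_l !exp_plus; ring.
have FG0 := Rmult_lt_0_compat _ _ F0 G0; have FGH0 := Rmult_lt_0_compat _ _ FG0 H0.
have mm : INR mF * INR mG * INR mH <= 8 * exp (INR n * (ra + rb + r)).
  rewrite e3; apply: Rmult_le_compat; try lra.
  by apply: Rmult_le_compat; lra.
have mono c m e : 0 < c -> 0 < m -> m <= e -> 0 <= m * c /\ ln (1 + m * c) <= ln (1 + e * c).
  move=> c0 m0 me; have cm := Rmult_lt_0_compat _ _ m0 c0; split; first lra.
  by apply: ln_le_mono; [lra | apply: Rplus_le_compat_l; apply: Rmult_le_compat_r; lra].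
have [q1 l1] := mono _ _ _ p1 FGH0 mm.
have [q2 l2] := mono _ _ _ p2 F0 F2.
have [q3 l3] := mono _ _ _ p3 G0 G2.
apply: Rle_trans (ln1D3_le q1 q2 q3) _.
exact: Rplus_le_compat (Rplus_le_compat _ _ _ _ l1 l2) l3.
Qed.

Lemma achievable_lt (c : 'I_3) (r : R) :
  (forall i, [\/ i = a, i = b | i = c]) -> 0 < r ->
  r < MI P cAB (coord c) -> MI P cAB (coord c) <= MI P (coord a) (coord b) ->
  sk_achievable_T P [set a; b] r.
Proof.
move=> cover r0 rI leI.
pose Ic := MI P cAB (coord c); pose Iab := MI P (coord a) (coord b).
(* With this [al], ra + rb = hab - (r + Ic) / 2 lies midway between hab - Ic = H(Xa,Xb|Xc), which
   terminal c needs, and hab - r, which secrecy allows. The talkers need [al] positive, and this is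
   where Ic <= Iab enters. *)
rewrite -/Ic -/Iab in rI leI; pose al := (Iab - (r + Ic) / 2) / 2.
pose ra := hab - Ent P (coord b) + al; pose rb := hab - Ent P (coord a) + al.
have al0 : 0 < al by rewrite /al; lra.
have refA : Ent P (coord a) <= hab by apply: Ent_refines => // x y [].
have refB : Ent P (coord b) <= hab by apply: Ent_refines => // x y [].
have ra0 : 0 < ra by rewrite /ra; lra.
have rb0 : 0 < rb by rewrite /rb; lra.
have IabE : Iab = Ent P (coord a) + Ent P (coord b) - hab by [].
have IcE : Ic = hab + Ent P (coord c) - Ent P (fun t => (cAB t, coord c t)) by [].
have ra_lt : ra < Ent P (coord a) by rewrite /ra /al; lra.
have rb_lt : rb < Ent P (coord b) by rewrite /rb /al; lra.
have rr : ra + rb = hab - (r + Ic) / 2 by rewrite /ra /rb /al; lra.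
have rabr : ra + rb + r < hab by lra.
pose mF n := exp_ceil (INR n * ra); pose mG n := exp_ceil (INR n * rb).
pose mH n := exp_ceil (INR n * r).
have bd n y : 0 < y -> exp (INR n * y) <= INR (exp_ceil (INR n * y)) <= 2 * exp (INR n * y).
  by move=> y0; apply: exp_ceil_bounds; apply: Rmult_le_pos; [exact: pos_INR | lra].
have mpos n y : 0 < y -> 0 < INR (exp_ceil (INR n * y)).
  by move/(bd n) => [le _]; have := exp_pos (INR n * y); lra.
have conf i delta : 0 < delta -> exists N, forall n, (N <= n)%N ->
    \sum_x (Pw n x * ln (1 + confusion_bound (Pw n) 'I_(mF n) 'I_(mG n)
       (@obs X a n) (@obs X b n) (@obs X i n) x)) <= delta.
  move=> d0; have [||||N hN] := @confusion_vanish i ra rb delta.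
  - have : Ent P (view i) + Ent P (coord b) <=
           Ent P (coord2 i b) + hab.
      apply: Ent_submod_le => // [x y []|x y []|x y [e _] [e1 e2]] //.
      by rewrite /view /coord2 e e1 e2.
    by rewrite /ra; lra.
  - have : Ent P (view i) + Ent P (coord a) <=
           Ent P (coord2 i a) + hab.
      apply: Ent_submod_le => // [x y []|x y []|x y [e _] [e1 e2]] //.
      by rewrite /view /coord2 e e1 e2.
    by rewrite /rb; lra.
  - case: (cover i) => ->.
    + have : Ent P (view a) <= hab by apply: Ent_refines => // x y [e1 e2]; rewrite /view /coord2 e1 e2.
      by rewrite /rb in rb0 *; lra.
    + have : Ent P (view b) <= hab by apply: Ent_refines => // x y [e1 e2]; rewrite /view /coord2 e1 e2.
      by rewrite /ra in ra0 *; lra.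
    + have : Ent P (view c) <= Ent P (fun t => (cAB t, coord c t)).
        by apply: Ent_refines => // x y [e1 e2 e3]; rewrite /view /coord2 e1 e2 e3.
      by rewrite rr; lra.
  - by [].
  by exists N => n Nn; apply: hN => //; [apply: (proj1 (bd n ra ra0)) | apply: (proj1 (bd n rb rb0))].
have vanish delta : 0 < delta -> exists N, forall n, (N <= n)%N ->
    protocol_error P a b n (mF n) (mG n) (mH n) <= delta.
  (* Three decoders at 2 * (delta / 8) each and the leakage at delta / 8 total 7/8 of delta. *)
  move=> d0; have d8 : 0 < delta / 8 by lra.
  have [N1 h1] := fin_all_exists (fun i => conf i _ d8).
  have [N2 h2] := leak_vanish ra_lt rb_lt rabr d8.
  exists (\max_i N1 i + N2)%N => n Nn.
  have le1 : \sum_(i : 'I_3) (2 * \sum_x (Pw n x * ln (1 + confusion_bound (Pw n) 'I_(mF n) 'I_(mG n)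
       (@obs X a n) (@obs X b n) (@obs X i n) x))) <= \sum_(i : 'I_3) (2 * (delta / 8)).
    apply: sumR_le => i _; apply: Rmult_le_compat_l; first lra.
    by apply: h1; apply: leq_trans Nn; apply: leq_trans (leq_addr _ _); exact: leq_bigmax.
  have le2 := h2 n (mF n) (mG n) (mH n) (leq_trans (leq_addl _ _) Nn)
     (conj (mpos n ra ra0) (proj2 (bd n ra ra0))) (conj (mpos n rb rb0) (proj2 (bd n rb rb0)))
     (conj (mpos n r r0) (proj2 (bd n r r0))).
  apply: Rle_trans (Rplus_le_compat _ _ _ _ le1 le2) _.
  by rewrite sumR_const card_ord /=; lra.
(* The scheme is chosen once for each block length, before any eps is given; [vanish] then serves
   every eps. *)
pose scheme n := constructive_indefinite_description _
  (exists_good_scheme P0 P1 a b n (mpos n ra ra0) (mpos n rb rb0) (mpos n r r0)).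
exists (fun n => (proj1_sig (scheme n)).1), (fun n => (proj1_sig (scheme n)).2); split; [|split].
- by move=> n; case: (proj2_sig (scheme n)).
- move=> eps [eps0 _]; have [N hN] := vanish eps eps0; exists N => n /hN le.
  case: (proj2_sig (scheme n)) => _ _ [Ji [loc pr]] _ _; exists Ji; split=> //.
  by apply: Rge_trans pr _; rewrite /mF /mG /mH in le; lra.
(* The successor keeps n >= 1, so that the total entropy loss eps is at most n * eps. *)
move=> eps eps0; have [N hN] := vanish eps eps0; exists N.+1 => n Nn.
have le := hN n (ltnW Nn).
case: (proj2_sig (scheme n)) => _ _ _ mi ent; split; first by apply: Rle_trans mi le.
have n1 : 1 <= INR n by apply: (le_INR 1); apply/leP; exact: leq_trans Nn.
have lnH : INR n * r <= ln (INR (mH n)).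
  rewrite -[X in X <= _]ln_exp; apply: ln_le_mono; first exact: exp_pos.
  exact: (proj1 (bd n r r0)).
apply: Rle_ge; apply: (Rmult_le_reg_r (INR n)); first lra.
set E := Ent _ _ in ent *.
have -> : E / INR n * INR n = E by field; lra.
have : eps * 1 <= eps * INR n by apply: Rmult_le_compat_l; lra.
rewrite /mF /mG /mH in le lnH; lra.
Qed.

End Achievability.

(** * Partitions of three terminals and the comparison of capacities *)

Section Partitions.
Variables (X : 'I_3 -> finType) (P : Sample X -> R).
Hypotheses (P0 : forall x, 0 <= P x) (P1 : \sum_x P x = 1).

(** A block with at least two of the three elements, in the presence of another block, leaves
    exactly one element outside. *)
Lemma partition_cases (Pi : {set {set 'I_3}}) : is_part Pi ->
  Pi = Ssing \/ exists c, Pi = [set [set c]; ~: [set c]].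
Proof.
case/andP => /and3P[/eqP cov triv n0] card1.
have ne B : B \in Pi -> B != set0 by apply: contraTneq => ->.
have disj B C : B \in Pi -> C \in Pi -> B != C -> [disjoint B & C].
  by move=> ? ?; move/trivIsetP: triv; apply.
have [/forallP all1|] := boolP [forall B in Pi, #|B| == 1%N].
  left; apply/setP => B; apply/idP/imsetP => [BPi|[i _ ->]].
    by have /implyP/(_ BPi)/cards1P[i ->] := all1 B; exists i.
  have : i \in finset.cover Pi by rewrite cov.
  case/bigcupP => C CPi iC; have /implyP/(_ CPi)/cards1P[j Cj] := all1 C.
  by move: iC; rewrite Cj inE => /eqP ->; rewrite -Cj.
case/forallPn => B; rewrite negb_imply => /andP[BPi B1]; right.
have /card_gt1P[C [D [CPi DPi CD]]] := card1.
have [E EPi EB] : exists2 E, E \in Pi & E != B.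
  by have [CB|] := eqVneq C B; [exists D => //; rewrite eq_sym -CB | exists C].
have sub E' : E' \in Pi -> E' != B -> E' \subset ~: B.
  by move=> E'Pi E'B; rewrite -disjoints_subset; apply: disj.
have B2 : (1 < #|B|)%N by rewrite ltn_neqAle eq_sym B1 card_gt0 ne.
have cE : #|~: B| = 1%N.
  have := cardsC B; rewrite card_ord => cB.
  have : (0 < #|~: B|)%N.
    by apply: leq_trans (subset_leq_card (sub E EPi EB)); rewrite card_gt0 ne.
  by move: cB B2; case: #|B| => [|[|[|[|k]]]] //; case: #|~: B| => [|[|]].
have /cards1P[c Cc] : #|~: B| == 1%N by rewrite cE.
have eqE E' : E' \in Pi -> E' != B -> E' = [set c].
  move=> E'Pi E'B; apply/eqP; have := sub _ E'Pi E'B.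
  by rewrite Cc subset1 (negbTE (ne _ E'Pi)) orbF.
exists c; have BC : ~: [set c] = B by rewrite -Cc setCK.
rewrite BC; apply/setP => A; rewrite !inE.
apply/idP/orP => [APi|[/eqP ->|/eqP ->//]].
  by have [->|AB] := eqVneq A B; [right | left; rewrite (eqE A)].
by rewrite -(eqE E).
Qed.

Lemma set1_neq_setC (c : 'I_3) : [set c] != ~: [set c].
Proof. by apply/eqP => /setP/(_ c); rewrite !inE eqxx. Qed.

Lemma set1_notin_setC (c : 'I_3) : [set c] \notin [set ~: [set c]].
Proof. by rewrite inE set1_neq_setC. Qed.

Lemma bipartition_is_part c : is_part [set [set c]; ~: [set c]].
Proof.
rewrite /is_part cards2 set1_neq_setC andbT; apply/and3P; split.
- by rewrite /finset.cover (big_setU1 _ (set1_notin_setC c)) big_set1 /= setUCr.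
- apply/trivIsetP => A B; rewrite !inE.
  by case/orP => /eqP -> /orP[] /eqP ->; rewrite ?eqxx // => _;
    rewrite -setI_eq0 ?setICr // setIC setICr.
rewrite !inE negb_or; apply/andP; split.
  by apply/eqP => /setP/(_ c); rewrite !inE eqxx.
rewrite eq_sym -card_gt0.
have := cardsC [set c]; rewrite cards1 card_ord.
by case: #|_|.
Qed.

Lemma card_Ssing : #|Ssing| = 3%N.
Proof. by rewrite card_imset ?card_ord //; exact: set1_inj. Qed.

Lemma bipartition_neq_Ssing c : [set [set c]; ~: [set c]] <> Ssing.
Proof.
move/(congr1 (fun S : {set {set 'I_3}} => #|S|)).
by rewrite card_Ssing cards2 set1_neq_setC.
Qed.

Definition cut (c : 'I_3) : R := MIA P (~: [set c]) [set c].

Lemma DeltaPart_bipartition c : DeltaPart P [set [set c]; ~: [set c]] = cut c.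
Proof.
rewrite /DeltaPart cards2 set1_neq_setC /finRsum.
rewrite (big_setU1 _ (set1_notin_setC c)) big_set1 /= /cut /MIA setUC setUCr.
by rewrite Rplus_comm; field.
Qed.

Lemma S_unique_minimizerE :
  S_unique_minimizer P <-> forall c, DeltaPart P Ssing < cut c.
Proof.
split=> [uniq c|lt Pi pPi nS].
  rewrite -DeltaPart_bipartition.
  exact: uniq (bipartition_is_part c) (@bipartition_neq_Ssing c).
by case: (partition_cases pPi) => [//|[c ->]]; rewrite DeltaPart_bipartition.
Qed.

Lemma Imulti_le Pi : is_part Pi -> Imulti P <= DeltaPart P Pi.
Proof.
move=> pPi; rewrite /Imulti; elim: (index_enum _) (mem_index_enum Pi) => // A s IH.
rewrite inE big_cons => /orP[/eqP <-|/IH le]; first by rewrite pPi; exact: Rmin_l.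
by case: ifP => _ //; apply: Rle_trans (Rmin_r _ _) le.
Qed.

Lemma Imulti_S_unique : S_unique_minimizer P -> DeltaPart P Ssing <= Imulti P.
Proof.
move=> uniq; rewrite /Imulti; elim/big_ind: _ => [|x y hx hy|Pi pPi]; first exact: Rle_refl.
  exact: Rmin_glb.
have [->|nS] := eqVneq Pi Ssing; first exact: Rle_refl.
by left; apply: uniq => //; exact/eqP.
Qed.

Section Triple.
Variables a b c : 'I_3.
Hypotheses (ab : a != b) (Eab : ~: [set c] = [set a; b]).

Lemma triple_cover i : [\/ i = a, i = b | i = c].
Proof.
move/setP/(_ i): Eab; rewrite !inE.
by case: (eqVneq i c) => [->|_ /esym/orP[/eqP|/eqP]]; [constructor 3 | constructor 1 | constructor 2].
Qed.

Lemma HA_set1 i : HA P [set i] = Ent P (coord i).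
Proof.
apply: Hrel_kernel => x y; apply/forall_inP/eqP => [/(_ i)|e j].
  by rewrite inE eqxx => /(_ isT)/eqP.
by rewrite inE => /eqP ->; apply/eqP.
Qed.

Lemma HA_pair : HA P (~: [set c]) = Ent P (coord2 a b).
Proof.
rewrite Eab; apply: Hrel_kernel => x y; apply/forall_inP/eqP => [h|[ea eb] j].
  by congr (_, _); apply/eqP/h; rewrite !inE eqxx ?orbT.
by rewrite !inE => /orP[] /eqP ->; apply/eqP.
Qed.

Lemma HA_setT : HA P setT = Ent P (fun x => (coord2 a b x, coord c x)).
Proof.
apply: Hrel_kernel => x y; apply/forall_inP/eqP => [h|[ea eb ec] j _].
  by do ![congr (_, _)]; apply/eqP/h.
by apply/eqP; case: (triple_cover j) => ->.
Qed.

Lemma cut_triple : cut c = MI P (coord2 a b) (coord c).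
Proof. by rewrite /cut /MIA setUC setUCr HA_set1 HA_pair HA_setT. Qed.

Lemma DeltaPart_Ssing :
  DeltaPart P Ssing = (MI P (coord a) (coord b) + cut c) / 2.
Proof.
have ca : a != c by move/setP/(_ a): Eab; rewrite !inE eqxx => ->.
have cb : b != c by move/setP/(_ b): Eab; rewrite !inE eqxx orbT => ->.
rewrite cut_triple /DeltaPart card_Ssing /finRsum big_imset; last by move=> ? ? _ _; exact: set1_inj.
rewrite (bigD1 c) //= (bigD1 a) //= (bigD1 b) /=; last by rewrite cb eq_sym.
rewrite big1 => [|i /andP[/andP[ic ia] ib]]; last first.
  by case: (triple_cover i) => e; move: ic ia ib; rewrite e eqxx.
rewrite !HA_set1 HA_setT /MI -/(coord2 a b).
move: (Ent P (fun x => (coord2 a b x, coord c x))) (Ent P (coord2 a b)) => u v.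
by move: (Ent P (coord a)) (Ent P (coord b)) (Ent P (coord c)) => p q r /=; field.
Qed.

End Triple.

Lemma card2_triple (T : {set 'I_3}) : #|T| = 2%N ->
  exists a b c, [/\ a != b, ~: [set c] = [set a; b] & T = [set a; b]].
Proof.
move/eqP/cards2P => [a [b [ab ET]]].
have /eqP/cards1P[c Ec] : #|~: T| = 1%N.
  have := cardsC T; rewrite ET cards2 ab card_ord.
  by case: #|_| => [|[|]].
by exists a, b, c; split=> //; rewrite -Ec setCK.
Qed.

Lemma T_capacity_lt : S_unique_minimizer P -> forall T : {set 'I_3}, #|T| = 2%N ->
  exists s : R, is_lub (sk_achievable_T P T) s /\ s < Imulti P.
Proof.
move=> uniq T /card2_triple[a [b [c [ab Eab ->]]]].
have ub : is_upper_bound (sk_achievable_T P [set a; b]) (MI P (coord a) (coord b)).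
  by move=> r; apply: rate_le_MI.
have [s hs] := completeness _ (ex_intro _ _ ub)
  (ex_intro _ 0 (zero_rate_achievable P1 [set a; b] (Rle_refl 0))).
exists s; split=> //.
have lt := proj1 S_unique_minimizerE uniq c; have le := Imulti_S_unique uniq.
have := hs.2 _ ub; have := DeltaPart_Ssing ab Eab; lra.
Qed.

Lemma S_unique_of_T_capacity_lt :
  (forall T : {set 'I_3}, #|T| = 2%N ->
     exists s : R, is_lub (sk_achievable_T P T) s /\ s < Imulti P) ->
  S_unique_minimizer P.
Proof.
move=> H; apply/S_unique_minimizerE => c; apply: Rnot_le_lt => le.
have T2 : #|~: [set c]| = 2%N.
  by have := cardsC [set c]; rewrite cards1 card_ord => -[].
have [s [[ub lub] sI]] := H _ T2.
have [a [b [c' [ab Ec' Eab]]]] := card2_triple T2.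
have leI := Imulti_le (bipartition_is_part c); rewrite DeltaPart_bipartition in leI.
have D := DeltaPart_Ssing ab Eab.
have s0 : 0 <= s by apply: ub; apply: zero_rate_achievable => //; exact: Rle_refl.
(* Since s < I(X_M) <= [cut c], the midpoint is a positive rate below [cut c], hence achievable, yet
   it exceeds the supremum s. *)
have : (s + cut c) / 2 <= s; last by lra.
apply: ub; rewrite Eab; apply: (@achievable_lt X P P0 P1 a b c).
- exact: triple_cover Eab.
- lra.
- by rewrite -(cut_triple Eab); lra.
- by rewrite -(cut_triple Eab); lra.
Qed.

End Partitions.

Theorem theorem5 (X : 'I_3 -> finType) (P : Sample X -> R)
  (hP0 : forall x, 0 <= P x) (hP1 : finRsum predT P = 1) :
  ((forall T : {set 'I_3}, #|T| = 2%N ->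
      exists s : R, is_lub (sk_achievable_T P T) s /\ (s < Imulti P))
   <-> S_unique_minimizer P)
  /\
  (S_unique_minimizer P <->
   (DeltaPart P Ssing <
    Rmin (MIA P [set t1; t2] [set t3])
         (Rmin (MIA P [set t1; t3] [set t2]) (MIA P [set t2; t3] [set t1])))).
Proof.
split; first by split; [exact: S_unique_of_T_capacity_lt | exact: T_capacity_lt].
have E3 : [set t1; t2] = ~: [set t3].
  by apply/setP => -[[|[|[|i]]] hi]; rewrite !inE -!val_eqE /= !inordK.
have E2 : [set t1; t3] = ~: [set t2].
  by apply/setP => -[[|[|[|i]]] hi]; rewrite !inE -!val_eqE /= !inordK.
have E1 : [set t2; t3] = ~: [set t1].
  by apply/setP => -[[|[|[|i]]] hi]; rewrite !inE -!val_eqE /= !inordK.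
rewrite E1 E2 E3 -/(cut P t1) -/(cut P t2) -/(cut P t3).
split=> [/S_unique_minimizerE lt|lt]; first by do 2 ?apply: Rmin_glb_lt.
have l3 := Rlt_le_trans _ _ _ lt (Rmin_l _ _).
have lt' := Rlt_le_trans _ _ _ lt (Rmin_r _ _).
have l2 := Rlt_le_trans _ _ _ lt' (Rmin_l _ _); have l1 := Rlt_le_trans _ _ _ lt' (Rmin_r _ _).
apply/S_unique_minimizerE => c.
have cover : c \in [set t1; t2] :|: [set t3] by rewrite E3 setUC setUCr inE.
by move: cover; rewrite !inE => /orP[/orP[]|] /eqP ->.
Qed.
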